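(* Let $d\in\mathbb{N}$, $d\ge1$, $0<\alpha<d$, and let $p,q,r$ be exponents satisfying $1<p,q<\frac d\alpha$, $r\ge1$, and $\frac1p+\frac1q=\frac1r+\frac\alpha d$. Then there is a constant $C=C(\alpha,d,p,q)>0$ such that for all nonnegative $f\in L^p(\mathbb{R}^d)$ and $g\in L^q(\mathbb{R}^d)$, $$\|J_\alpha(f,g)\|_{L^r(\mathbb{R}^d)}\le C\,\|f\|_{L^p(\mathbb{R}^d)}\,\|g\|_{L^q(\mathbb{R}^d)}.$$
   Context: For nonnegative measurable functions $f,g$ on $\mathbb{R}^d$, the tensor ($d\times d$ matrix)-valued bilinear operator $J_\alpha$ is $$J_\alpha(f,g)(x)=\int_0^1\int_{\mathbb{R}^d}f(x+(\theta-1)y)\,g(x+\theta y)\,|y|^{\alpha-d-2}\,y\otimes y\,\mathrm{d}y\,\mathrm{d}\theta,$$ where $y\otimes y=(y_iy_j)_{i,j}$. The $L^r$ norm of the matrix-valued function $J_\alpha(f,g)$ is the $L^r$ norm of $x\mapsto|J_\alpha(f,g)(x)|$, with $|\cdot|$ the operator norm $|M|=\sup_{v\ne0}|Mv|/|v|$. *)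

(* Defs.v *)
From HB Require Import structures.
From mathcomp Require Import all_boot all_order all_algebra.
From mathcomp Require Import all_classical all_reals all_analysis.

Set Implicit Arguments.
Unset Strict Implicit.
Unset Printing Implicit Defensive.
Import Order.TTheory GRing.Theory Num.Theory.
Import numFieldNormedType.Exports.

Local Open Scope classical_set_scope.
Local Open Scope ring_scope.

(* Points of R^n are row vectors; R^n carries the product sigma-algebra, i.e.
   the one generated by the coordinate functions (the Borel sets of R^n). *)
Section measurable_rV.
Context (R : realType) (n : nat).

Let coord : 'I_n -> 'rV[R]_n -> R := fun i x => x ord0 i.

Let rV_set0 : g_sigma_preimage coord set0.
Proof. exact: sigma_algebra0. Qed.

Let rV_setC A : g_sigma_preimage coord A -> g_sigma_preimage coord (~` A).
Proof. exact: sigma_algebraC. Qed.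

Let rV_bigcup (F : (set 'rV[R]_n)^nat) :
  (forall i, g_sigma_preimage coord (F i)) ->
  g_sigma_preimage coord (\bigcup_i (F i)).
Proof. exact: sigma_algebra_bigcup. Qed.

HB.instance Definition _ := @isMeasurable.Build default_measure_display
  'rV[R]_n (g_sigma_preimage coord) rV_set0 rV_setC rV_bigcup.

End measurable_rV.

Section measurable_rV_lemmas.
Context (R : realType).

Lemma measurable_coord n (i : 'I_n) :
  measurable_fun [set: 'rV[R]_n] (fun x : 'rV[R]_n => x ord0 i).
Proof.
move=> _ Y mY; rewrite setTI; apply: sub_sigma_algebra => /=.
rewrite -bigcup_seq/=; exists i => /=; first by rewrite mem_index_enum.
by exists Y => //; rewrite setTI.
Qed.

Lemma measurable_fun_rV d (T : measurableType d) n (f : T -> 'rV[R]_n) :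
  (forall i, measurable_fun [set: T] (fun t => f t ord0 i)) ->
  measurable_fun [set: T] f.
Proof.
move=> mf _ A mA; rewrite setTI.
have : g_sigma_preimage (fun i t => f t ord0 i) `<=` @measurable _ T.
  apply: smallest_sub; first exact: sigma_algebra_measurable.
  move=> B; rewrite -bigcup_seq => -[i _ [C mC <-]].
  exact: mf.
apply.
have := @g_sigma_preimage_comp _ R n 'rV[R]_n
  (fun i x => x ord0 i) T f.
rewrite (_ : (fun i => _ \o f) = (fun i t => f t ord0 i))// => ->.
by exists A => //; rewrite setTI.
Qed.

Definition rV_cons n (z : R * 'rV[R]_n) : 'rV[R]_n.+1 :=
  @row_mx R 1 1 n z.1%:M z.2.

Lemma rV_consEl n (z : R * 'rV[R]_n) : rV_cons z ord0 ord0 = z.1.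
Proof.
rewrite (_ : ord0 = @lshift 1 n ord0); last exact: val_inj.
by rewrite [LHS](@row_mxEl R 1 1 n) mxE.
Qed.

Lemma rV_consEr n (z : R * 'rV[R]_n) i :
  rV_cons z ord0 (lift ord0 i) = z.2 ord0 i.
Proof.
rewrite (_ : lift ord0 i = @rshift 1 n i); last exact: val_inj.
exact: (@row_mxEr R 1 1 n).
Qed.

Lemma measurable_rV_cons n :
  measurable_fun [set: R * 'rV[R]_n] (@rV_cons n).
Proof.
apply: measurable_fun_rV => i.
have [->|[j ->]] : i = ord0 \/ exists j, i = lift ord0 j.
    by case: (unliftP ord0 i) => [j ->|->]; [right; exists j|left].
  by under eq_fun do rewrite rV_consEl; exact: measurable_fst.
under eq_fun do rewrite rV_consEr.
apply: (measurableT_comp (measurable_coord j)); exact: measurable_snd.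
Qed.

Definition rV_uncons n (x : 'rV[R]_n.+1) : R * 'rV[R]_n :=
  (x ord0 ord0, \row_i x ord0 (lift ord0 i)).

Lemma measurable_rV_uncons n :
  measurable_fun [set: 'rV[R]_n.+1] (@rV_uncons n).
Proof.
apply: measurable_fun_pair => /=; first exact: measurable_coord.
apply: measurable_fun_rV => i.
under eq_fun do rewrite mxE.
exact: measurable_coord.
Qed.

Lemma rV_consK n : cancel (@rV_cons n) (@rV_uncons n).
Proof.
move=> [t x]; rewrite /rV_uncons rV_consEl; congr pair.
by apply/rowP => i; rewrite mxE rV_consEr.
Qed.

End measurable_rV_lemmas.

Section lebesgue_rV.
Context (R : realType).

Section lebesgue_cons.
Context (n : nat) (mu : {sigma_finite_measure set 'rV[R]_n -> \bar R}).

Definition lebesgue_cons : set 'rV[R]_n.+1 -> \bar R :=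
  pushforward (@lebesgue_measure R \x mu)%E (@rV_cons R n).

HB.instance Definition _ := Measure.copy lebesgue_cons
  (measure_function_pushforward__canonical__measure_function_Measure
    (@lebesgue_measure R \x mu)%E (@measurable_rV_cons R n)).

Let sigma_finite_lebesgue_cons : sigma_finite setT lebesgue_cons.
Proof.
have /sigma_finiteP[F [TF ndF Foo]] := sigma_finiteT (@lebesgue_measure R).
have /sigma_finiteP[G [TG ndG Goo]] := sigma_finiteT mu.
exists (fun k => @rV_uncons R n @^-1` (F k `*` G k)).
  apply/esym/seteqP; split => // x _.
  have : [set: R] (rV_uncons x).1 by [].
  have : [set: 'rV[R]_n] (rV_uncons x).2 by [].
  rewrite TF TG => -[k _ Gk] [l _ Fl]; exists (maxn k l) => //; split.
    by move: Fl; apply/subsetPset/ndF/leq_maxr.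
  by move: Gk; apply/subsetPset/ndG/leq_maxl.
move=> k; have [mF Fk] := Foo k; have [mG Gk] := Goo k.
have mFG : measurable (F k `*` G k) by exact: measurableX.
split.
  by rewrite -[X in measurable X]setTI; exact: measurable_rV_uncons.
rewrite /lebesgue_cons /pushforward -comp_preimage.
rewrite (_ : _ \o _ = id); last by apply/funext => z /=; rewrite rV_consK.
by rewrite preimage_id product_measure1E// lte_mul_pinfty// ge0_fin_numE.
Qed.

HB.instance Definition _ := @Measure_isSigmaFinite.Build _ _ _
  lebesgue_cons sigma_finite_lebesgue_cons.

End lebesgue_cons.

(* Lebesgue measure on R^n as the n-fold product of Lebesgue measure on R,
   transported along R * R^n ~ R^n.+1. *)
Fixpoint lebesgue_rV (n : nat) :
    {sigma_finite_measure set 'rV[R]_n -> \bar R} :=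
  match n with
  | 0 => \d_(0 : 'rV[R]_0)
  | n'.+1 => lebesgue_cons (lebesgue_rV n')
  end.

End lebesgue_rV.
Arguments lebesgue_rV {R} n.

Section tensor.
Context (R : realType) (d : nat).

(* The norm `|x| of the library is the sup norm on 'rV. *)
Definition eucl_norm (x : 'rV[R]_d) : R := Num.sqrt (\sum_i x ord0 i ^+ 2).

Definition tensor (x y : 'rV[R]_d) : 'M[R]_d :=
  \matrix_(i, j) (x ord0 i * y ord0 j).

Local Open Scope ereal_scope.

(* Matrices with extended-real entries act on real vectors with the convention
   0 * +oo = 0.  If an entry M i j is infinite then |M e_j| = +oo, hence
   op_norm M = +oo; if all entries are finite then op_norm M is the usual
   operator norm. *)
Definition emx_apply (M : 'M[\bar R]_d) (v : 'rV[R]_d) : 'I_d -> \bar R :=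
  fun i => \sum_(j < d) M i j * (v ord0 j)%:E.

Definition eeucl_norm (w : 'I_d -> \bar R) : \bar R :=
  sqrte (\sum_(i < d) `|w i| ^+ 2).

Definition op_norm (M : 'M[\bar R]_d) : \bar R :=
  ereal_sup [set eeucl_norm (emx_apply M v) * ((eucl_norm v)^-1)%:E
            | v in [set v : 'rV[R]_d | v != 0%R]].

(* The entries are extended-real valued, so that divergence of the integral is
   not masked: for nonnegative f and g the diagonal entries are integrals of
   nonnegative functions and the integrand of every entry is dominated by that
   of the trace, so either all entries are absolutely convergent integrals or
   some diagonal entry, and then op_norm, is +oo.  At y = 0 the integrand is 0
   whatever the value of the power. *)
Definition J (alpha : R) (f g : 'rV[R]_d -> R) (x : 'rV[R]_d) : 'M[\bar R]_d :=
  \matrix_(i, j)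
    \int[lebesgue_measure]_(theta in `[0%R, 1%R])
      \int[lebesgue_rV d]_y
        (f (x + (theta - 1) *: y) * g (x + theta *: y)
         * eucl_norm y `^ (alpha - d%:R - 2) * tensor y y i j)%R%:E.

End tensor.
Arguments op_norm {R d} M.

(* Main.v *)
Require Import Defs.
From HB Require Import structures.
From mathcomp Require Import all_boot all_order all_algebra.
From mathcomp Require Import all_classical all_reals all_analysis.
From mathcomp Require Import measurable_realfun.
From mathcomp Require Import ring lra.

Set Implicit Arguments.
Unset Strict Implicit.
Unset Printing Implicit Defensive.
Import Order.TTheory GRing.Theory Num.Theory.
Import numFieldNormedType.Exports.

Local Open Scope classical_set_scope.
Local Open Scope ring_scope.

(** Put [t = alpha / d], [a = 1 / p], [b = 1 / q] and [c = 1 - 1 / r].  Then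
    [a + b + c = 1 + t], where [a] and [b] lie strictly between [t] and 1, and
    [0 <= c < 1].  By duality ([poweR_integral_le_dual]) the estimate follows from
    a bound, uniform in [theta], for the trilinear form
    [\int\int phi(x + (theta-1) y)^a psi(x + theta y)^b eta(x)^c k(y) dx dy]
    by [C (\int phi)^a (\int psi)^b (\int eta)^c], applied to [phi = f^p] and
    [psi = g^q].  Writing everything with powers of functions of finite integral
    includes the case [r = 1], which is [c = 0].

    The operator norm is at most a dimensional constant times the largest entry,
    so the kernel is [|y|^(alpha-d)].  It is at most the product of the
    [|y_i|^(t-1)] ([kernel_le_riesz_rV]), and for a product kernel the estimate
    passes from the line to dimension [d] one coordinate at a time
    ([trilinear_rV]): the exponents are the same in every dimension, so that the
    inequality applied to slices reproduces a form of the same type.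

    On the line, the Hardy-Littlewood-Sobolev inequality for two functions
    ([hls_line]) has a short proof.  Normalize both integrals to be at most 1 and
    let [A + B = 1 + t] with [A, B < 1].  Where [psi <= phi], fix the point at
    which [phi] is evaluated, and call [u] the value there.  The part of the
    integral in [y] with [|y| <= 1 / u] is controlled by [psi <= u], the other
    part by the integrals of [psi] and of the tail of a power of [|y|]; all of
    them give a multiple of [u], and the integral of [phi] is at most 1.
    Where [phi <= psi], exchange the roles.

    Three functions are reduced to two by writing the product as a geometric mean
    of two products of two factors, and bounding it by their sum.  The three
    points [x + (theta-1) y], [x + theta y], [x] are at mutual distances [|y|],
    [|1 - theta| |y|] and [|theta| |y|].  If [|1 - theta| >= 1/2], one pairs the
    first point with each of the others; this requires [t < a], that is
    [p < d / alpha].  Otherwise [|theta| >= 1/2] and one pairs the second point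
    with the others, which requires [t < b].  In both cases only distances
    comparable to [|y|] occur, so the constant does not depend on [theta]
    ([trilinear_line]). *)

(** * Integrals: monotonicity without measurability, affine substitutions *)

Section integral_monotone.
Context d (T : measurableType d) (R : realType).
Variable mu : {measure set T -> \bar R}.
Local Open Scope ereal_scope.

(** The integral of a nonnegative function is a supremum over the simple
    functions below it, so it is monotone on all functions, such as the entries of
    [J] and the composition with [op_norm], whose measurability is not obvious. *)
Lemma le_integral_nonmeasurable (D : set T) (f g : T -> \bar R) :
  (forall x, D x -> 0 <= f x) -> (forall x, D x -> f x <= g x) ->
  \int[mu]_(x in D) f x <= \int[mu]_(x in D) g x.
Proof.
move=> f0 fg.
have g0 x : D x -> 0 <= g x by move=> Dx; exact: le_trans (f0 _ Dx) (fg _ Dx).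
rewrite !ge0_integralE//; apply: ereal_sup_le => _ [h /= hf <-].
exists h => // x; rewrite (le_trans (hf x))//; apply: lee_restrict => //.
Qed.

Lemma abse_integral_nonmeasurable (D : set T) (f : T -> \bar R) :
  `|\int[mu]_(x in D) f x| <= \int[mu]_(x in D) `|f x|.
Proof.
rewrite integralE.
have fp : \int[mu]_(x in D) f^\+ x <= \int[mu]_(x in D) `|f x|.
  apply: le_integral_nonmeasurable => // x _.
  by rewrite -[leRHS]/((abse \o f) x) fune_abse leeDl.
have fn : \int[mu]_(x in D) f^\- x <= \int[mu]_(x in D) `|f x|.
  apply: le_integral_nonmeasurable => // x _.
  by rewrite -[leRHS]/((abse \o f) x) fune_abse leeDr.
have fp0 : 0 <= \int[mu]_(x in D) f^\+ x by exact: integral_ge0.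
have fn0 : 0 <= \int[mu]_(x in D) f^\- x by exact: integral_ge0.
move: fp fn fp0 fn0.
case: (\int[mu]_(x in D) `|f x|) => [m||]; last 2 first.
- by move=> *; rewrite leey.
- by case: (\int[mu]_(x in D) f^\+ x).
case: (\int[mu]_(x in D) f^\+ x) => [a| |] //.
case: (\int[mu]_(x in D) f^\- x) => [b| |] //.
rewrite -EFinB abse_EFin !lee_fin => am bm a0 b0.
by rewrite ler_norml; apply/andP; split; lra.
Qed.

End integral_monotone.

Section affine_change.
Context (R : realType).
Local Open Scope ereal_scope.
Local Notation mu := (@lebesgue_measure R).

(** Translates and dilates of Lebesgue measure are identified by their values on
    half-open intervals. *)
Lemma ge0_integral_shift (f : R -> \bar R) (c : R) :
  measurable_fun [set: R] f -> (forall r, 0 <= f r) ->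
  \int[mu]_x f (x + c)%R = \int[mu]_x f x.
Proof.
move=> mf f0.
pose phi (x : measurableTypeR R) : measurableTypeR R := (x + c)%R.
have mphi : measurable_fun setT phi by exact: measurable_funD.
have := @ge0_integral_pushforward _ _ _ _ R phi mphi mu setT f measurableT mf.
rewrite preimage_setT => <-//.
apply: eq_measure_integral => A mA _; apply/esym.
apply: lebesgue_measure_unique => // _ [[a b]] _ <-.
rewrite /= /pushforward (_ : _ @^-1` _ = `](a - c)%R, (b - c)%R]%classic); last first.
  by apply/seteqP; split => x /=; rewrite !in_itv/= ltrBlDr lerBrDr.
rewrite !lebesgue_measure_itv/= !lte_fin ltrD2r; case: ifPn => // _.
by rewrite -!EFinB; congr EFin; lra.
Qed.

Lemma ge0_integral_scale (f : R -> \bar R) (s : R) : s != 0%R ->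
  measurable_fun [set: R] f -> (forall r, 0 <= f r) ->
  \int[mu]_x f (s * x)%R = (`|s|^-1)%:E * \int[mu]_x f x.
Proof.
move=> s0 mf f0.
pose phi (x : measurableTypeR R) : measurableTypeR R := (s * x)%R.
have mphi : measurable_fun setT phi by exact: measurable_funM.
have := @ge0_integral_pushforward _ _ _ _ R phi mphi mu setT f measurableT mf.
rewrite preimage_setT => /(_ (fun y _ => f0 y)) pE.
have sE : \int[mu]_x f x = `|s|%:E * \int[mu]_x f (s * x)%R.
  rewrite -[X in _ * X]pE -(ge0_integral_mscale _ measurableT (NngNum (normr_ge0 s)))//.
  apply: eq_measure_integral => A mA _; apply: lebesgue_measure_unique => // _ [[a b]] _ <-.
  rewrite /= /mscale/= /pushforward/=.
  move: s0; rewrite neq_lt => /orP[s0|s0].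
    rewrite (_ : _ @^-1` _ = `[(b / s)%R, (a / s)%R[%classic); last first.
      by apply/seteqP; split => x /=; rewrite !in_itv/= ler_ndivrMr// ltr_ndivlMr// mulrC andbC.
    rewrite !lebesgue_measure_itv/= !lte_fin ltr_nM2r ?invr_lt0//.
    case: ifPn => // _; last by rewrite mule0.
    rewrite -!EFinB -EFinM; congr EFin; rewrite ltr0_norm//; field.
    by rewrite lt_eqF.
  rewrite (_ : _ @^-1` _ = `](a / s)%R, (b / s)%R]%classic); last first.
    by apply/seteqP; split => x /=; rewrite !in_itv/= ler_pdivlMr// ltr_pdivrMr// mulrC.
  rewrite !lebesgue_measure_itv/= !lte_fin ltr_pM2r ?invr_gt0//.
  case: ifPn => // _; last by rewrite mule0.
  rewrite -!EFinB -EFinM; congr EFin; rewrite gtr0_norm//; field.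
  by rewrite gt_eqF.
by rewrite sE muleA -EFinM mulVf ?normr_eq0// mul1e.
Qed.

End affine_change.

(** * An integrable majorant of a truncated power *)

Section power_majorant.
Context (R : realType).
Local Open Scope ereal_scope.
Local Notation mu := (@lebesgue_measure R).

(** A series of multiples of indicators of centred intervals whose areas form a
    geometric progression: integrability is term by term, and a point of the
    [n]-th interval sees at least the height [c n]. *)
Lemma geometric_step_majorant (c rho : nat -> R) (a q : R) :
  (forall n, 0 <= c n)%R -> (forall n, 0 <= rho n)%R ->
  (0 <= a)%R -> (0 < q < 1)%R -> (forall n, c n * rho n = a * q ^+ n)%R ->
  exists G : R -> \bar R,
    [/\ measurable_fun [set: R] G, (forall z, 0 <= G z),
        (forall n z, (`|z| <= rho n)%R -> (c n)%:E <= G z) &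
        \int[mu]_z G z <= (2 * a / (1 - q))%:E].
Proof.
move=> c0 rho0 a0 /andP[q0 q1] crho.
pose u n (z : R) : \bar R := (c n * \1_(`[- rho n, rho n]%classic) z)%:E.
have u0 n z : 0 <= u n z by rewrite lee_fin mulr_ge0.
have mu_ n : measurable_fun [set: R] (u n).
  by apply/measurable_EFinP; apply: measurable_funM.
exists (fun z => \sum_(n <oo) u n z); split.
- by apply: ge0_emeasurable_sum => // n _.
- by move=> z; apply: nneseries_ge0.
- move=> n z zn; apply: (@le_trans _ _ (u n z)).
    rewrite lee_fin indicE mem_set ?mulr1//=.
    by rewrite in_itv/= -ler_norml.
  apply: (@le_trans _ _ (\sum_(0 <= i < n.+1) u i z)).
    by rewrite big_nat_recr//= leeDr// sume_ge0.
  by apply: nneseries_lim_ge.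
- rewrite integral_nneseries//.
  apply: lime_le; first by apply: is_cvg_nneseries => n _ _; exact: integral_ge0.
  apply: nearW => n.
  have -> : \sum_(0 <= i < n) \int[mu]_z u i z
      = (series (geometric (2 * a) q) n)%:E.
    rewrite /series/= -sumEFin; apply: eq_bigr => i _.
    rewrite /u; under eq_integral do rewrite EFinM.
    rewrite ge0_integralZl//; last 2 first.
    + by apply/measurable_EFinP; exact: measurable_indic.
    + by rewrite lee_fin.
    rewrite integral_indic//= setIT lebesgue_measure_itv/= lte_fin.
    case: ifPn => [_|]; last first.
      rewrite -leNgt => h; have r0 : rho i = 0%R by have := rho0 i; lra.
      by rewrite mule0 -mulrA -crho r0 !mulr0.
    by rewrite -EFinB -EFinM; congr EFin; rewrite -mulrA -crho; ring.
  rewrite lee_fin geometric_le_lim ?mulr_ge0//.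
  by rewrite gtr0_norm.
Qed.

(** The profile [min (|z|^(t-1), |z|^(-b))] is integrable at the origin because
    [t > 0] and at infinity because [b > 1]; it suffices to dominate it by steps
    at the scales [e^n].  The value at the origin is infinite, to match the
    singularity of the kernel there. *)
Lemma power_majorant (t b : R) : (0 < t < 1)%R -> (1 < b)%R ->
  exists (kappa : R -> \bar R) (K : R),
    [/\ measurable_fun [set: R] kappa, (forall z, 0 <= kappa z),
        (kappa 0%R = +oo) /\
        (forall z, (0 < `|z| <= 1)%R -> (`|z| `^ (t - 1))%:E <= kappa z),
        (forall z, (1 <= `|z|)%R -> (`|z| `^ (- b))%:E <= kappa z) &
        \int[mu]_z kappa z <= K%:E].
Proof.
move=> /andP[t0 t1] b1.
have [|||||G1 [mG1 G10 G1le iG1]] := @geometric_step_majorant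
  (fun n => expR ((1 - t) * n.+1%:R)) (fun n => expR (- n%:R)) (expR (1 - t)) (expR (- t)).
- by move=> n; exact: expR_ge0.
- by move=> n; exact: expR_ge0.
- exact: expR_ge0.
- by rewrite expR_gt0 expR_lt1 oppr_lt0.
- move=> n; rewrite -expRM_natr -!expRD; congr expR.
  by rewrite -natr1; ring.
have [|||||G2 [mG2 G20 G2le iG2]] := @geometric_step_majorant
  (fun n => expR (- b * n%:R)) (fun n => expR n.+1%:R) (expR 1) (expR (1 - b)).
- by move=> n; exact: expR_ge0.
- by move=> n; exact: expR_ge0.
- exact: expR_ge0.
- by rewrite expR_gt0 expR_lt1 subr_lt0.
- move=> n; rewrite -expRM_natr -!expRD; congr expR.
  by rewrite -natr1; ring.
(* An infinite value at one point costs nothing in the integral. *)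
pose H (z : R) : \bar R := +oo * (\1_[set 0%R] z)%:E.
have H0 z : 0 <= H z by rewrite mule_ge0// lee_fin.
have mI : measurable_fun [set: R] (fun z : R => (\1_[set 0%R] z)%:E : \bar R).
  by apply/measurable_EFinP; exact: measurable_indic.
have mH : measurable_fun [set: R] H by exact: emeasurable_funM.
exists (fun z => G1 z + G2 z + H z).
exists (2 * expR (1 - t) / (1 - expR (- t)) + 2 * expR 1 / (1 - expR (1 - b)))%R.
split.
- by apply: emeasurable_funD => //; exact: emeasurable_funD.
- by move=> z; rewrite !adde_ge0.
- split.
    rewrite /H indicE mem_set//= mulr1n mule1 addey//.
    by rewrite gt_eqF// (@lt_le_trans _ _ 0)// adde_ge0.
  move=> z /andP[z0 z1].
  apply: (@le_trans _ _ (G1 z)); last by rewrite -addeA leeDl// adde_ge0.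
  pose s := (- ln `|z|)%R.
  have zE : `|z|%R = expR (- s) by rewrite opprK lnK.
  have s0 : (0 <= s)%R by rewrite oppr_ge0 ln_le0.
  have /andP[ns sn] := truncn_itv s0.
  apply: le_trans (G1le (Num.trunc s) z _); last first.
    by rewrite zE ler_expR lerN2.
  rewrite lee_fin /powR gt_eqF// zE expRK ler_expR.
  rewrite mulrN -mulNr opprB; apply: ler_wpM2l; last exact: ltW.
  by rewrite subr_ge0 ltW.
- move=> z z1.
  apply: (@le_trans _ _ (G2 z)); last by rewrite addeAC leeDr// adde_ge0.
  have z0 : (0 < `|z|)%R by rewrite (lt_le_trans _ z1).
  pose s := ln `|z|%R.
  have zE : `|z|%R = expR s by rewrite lnK.
  have s0 : (0 <= s)%R by rewrite ln_ge0.
  have /andP[ns sn] := truncn_itv s0.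
  apply: le_trans (G2le (Num.trunc s) z _); last first.
    by rewrite zE ler_expR ltW.
  rewrite lee_fin /powR gt_eqF// zE expRK ler_expR.
  by rewrite !mulNr lerN2 ler_wpM2l//; lra.
- rewrite ge0_integralD//; last 2 first.
  + by move=> z _; rewrite adde_ge0.
  + exact: emeasurable_funD.
  rewrite ge0_integralD// ge0_integralZl//.
  rewrite integral_indic//= setIT lebesgue_measure_set1 mule0 adde0 EFinD.
  exact: leeD.
Qed.

End power_majorant.

(** * The Hardy-Littlewood-Sobolev inequality on the line *)

Section poweR_facts.
Context (R : realType).
Local Open Scope ereal_scope.
Implicit Types x y : \bar R.

Lemma ge0_le_poweR (r : R) x y : (0 <= r)%R -> 0 <= x -> x <= y -> x `^ r <= y `^ r.
Proof.
move=> r0 x0 xy; apply: gt0_ler_poweR => //.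
- by rewrite in_itv/= x0 leey.
- by rewrite in_itv/= leey (le_trans x0).
Qed.

Lemma geometric_mean_le_add (l : R) x y : (0 <= l <= 1)%R -> 0 <= x -> 0 <= y ->
  x `^ l * y `^ (1 - l) <= x + y.
Proof.
move=> /andP[l0 l1] x0 y0.
have m0 : 0 <= maxe x y by rewrite le_max x0.
apply: (@le_trans _ _ (maxe x y)).
  rewrite -[leRHS]poweRe1// -[in leRHS](subrKC l 1%R) [leRHS]poweRD; last first.
    by apply: add_neq0_poweRD_def; rewrite subrKC oner_neq0.
  apply: lee_pmul; rewrite ?poweR_ge0//.
    by apply: ge0_le_poweR => //; rewrite le_max lexx.
  by apply: ge0_le_poweR; rewrite ?subr_ge0// le_max lexx orbT.
by rewrite ge_max leeDl// leeDr.
Qed.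

End poweR_facts.

(** The value at the origin is infinite, and not the value 0 that the real power
    takes there: the product of these kernels over the coordinates has to dominate
    the radial kernel also on the coordinate hyperplanes. *)
Definition riesz (R : realType) (t y : R) : \bar R :=
  if y == 0 then +oo%E else (`|y| `^ (t - 1))%:E.

Section riesz.
Context (R : realType) (t : R).
Local Open Scope ereal_scope.

Lemma riesz_gt0 y : 0 < riesz t y.
Proof. by rewrite /riesz; case: ifPn => // y0; rewrite lte_fin powR_gt0 ?normr_gt0. Qed.

Lemma riesz_ge0 y : 0 <= riesz t y.
Proof. exact/ltW/riesz_gt0. Qed.

Lemma measurable_riesz : measurable_fun [set: R] (riesz t).
Proof.
apply: measurable_fun_ifT => //.
  apply: (measurable_fun_bool true) => //.
  rewrite setTI (_ : _ @^-1` _ = [set 0%R]); last first.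
    by apply/seteqP; split => y /= /eqP.
  exact: measurable_set1.
apply/measurable_EFinP.
exact: (measurableT_comp (measurable_powR _) (@normr_measurable _ _)).
Qed.

End riesz.

Section hls_pointwise.
Context (R : realType).
Local Open Scope ereal_scope.

(** The bound used in the region [v <= u], where [u] and [v] are the values of the
    two functions at points whose distance is proportional to [|y|].  When [y] ranges over the
    line, the dilation by [u] and the integrability of [kappa] and [v] make the
    integral of the bracket a constant, so that only the factor [u] is left. *)
Definition schur (kappa : R -> \bar R) (u v : \bar R) (y : R) : \bar R :=
  u * (u * kappa (fine u * y)%R + v).

Lemma schur_ge0 kappa u v y : (forall z, 0 <= kappa z) -> 0 <= u -> 0 <= v ->
  0 <= schur kappa u v y.
Proof. by move=> k0 u0 v0; rewrite mule_ge0// adde_ge0// mule_ge0. Qed.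

(** For [u |y| <= 1], replace [v] by [u] and use [A + B = 1 + t].  For
    [u |y| > 1], the left side is [u v^B w^(1-B)] with [w = u (u |y|)^(-b)] and
    [b = (1-t)/(1-B)], and a geometric mean is at most the sum.  The exponent
    [b] exceeds 1 because [A < 1] forces [t < B]. *)
Lemma le_schur (t A B : R) (kappa : R -> \bar R) (u v : \bar R) (y : R) :
  (0 < t < 1)%R -> (A < 1)%R -> (B < 1)%R -> (A + B = 1 + t)%R ->
  (forall z, 0 <= kappa z) -> kappa 0%R = +oo ->
  (forall z, (0 < `|z| <= 1)%R -> (`|z| `^ (t - 1))%:E <= kappa z) ->
  (forall z, (1 <= `|z|)%R -> (`|z| `^ (- ((1 - t) / (1 - B))))%:E <= kappa z) ->
  0 <= v -> v <= u ->
  u `^ A * v `^ B * riesz t y <= schur kappa u v y.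
Proof.
move=> /andP[t0 t1] A1 B1 AB k0 kz near far v0 vu.
have u0 := le_trans v0 vu.
have R0 : 0 <= schur kappa u v y by exact: schur_ge0.
have A0 : (A != 0)%R by apply/eqP; lra.
have B0 : (B != 0)%R by apply/eqP; lra.
have [v0'|vp] := eqVneq v 0; first by rewrite v0' in R0 *; rewrite poweR0r// mule0 mul0e.
have {vp}v0' : 0 < v by rewrite lt_def vp.
have u0' := lt_le_trans v0' vu.
case: u => [s| |] // in vu u0 u0' R0 *; last first.
  rewrite [leRHS](_ : _ = +oo) ?leey// /schur gt0_mulye//.
  by rewrite (lt_le_trans v0')// leeDr// mule_ge0.
case: v => [v| |] // in vu v0 v0' R0 *.
rewrite !lte_fin !lee_fin in u0 v0 u0' v0' vu.
rewrite /schur/= /riesz; have [->|y0] := eqVneq y 0%R.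
  rewrite mulr0 kz [X in _ <= _ * (X + _)]gt0_muley ?lte_fin// addye//.
  by rewrite [leRHS]gt0_muley ?lte_fin ?leey.
have ay0 : (0 < `|y|)%R by rewrite normr_gt0.
have nsy : (`|s * y| = s * `|y|)%R by rewrite normrM (gtr0_norm u0').
have sy0 : (0 < s * `|y|)%R by rewrite mulr_gt0.
rewrite ?poweR_EFin -!EFinM.
have [sy1|sy1] := leP (s * `|y|)%R 1%R.
  apply: (@le_trans _ _ (s%:E * (s%:E * (`|s * y| `^ (t - 1))%:E))); last first.
    rewrite lee_pmul2l ?lte_fin//.
    apply: (@le_trans _ _ (s%:E * kappa (s * y)%R)); last by rewrite leeDl ?lee_fin.
    by rewrite lee_pmul2l ?lte_fin// near// nsy sy0.
  rewrite -!EFinM lee_fin nsy powRM// mulrA mulrA.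
  apply: ler_wpM2r; first exact: powR_ge0.
  rewrite -[X in (X * X * _)%R]powRr1// -!powRD; try by apply/implyP => _; rewrite gt_eqF.
  apply: (@le_trans _ _ (s `^ A * s `^ B)%R).
    by apply: ler_wpM2l; [exact: powR_ge0|rewrite ge0_ler_powR//; lra].
  rewrite -powRD; last by apply/implyP => _; rewrite gt_eqF.
  by rewrite AB; have -> : (1 + 1 + (t - 1) = 1 + t)%R by ring.
set b := ((1 - t) / (1 - B))%R in far.
set w := (s * (s * `|y|) `^ (- b))%R.
apply: (@le_trans _ _ (s%:E * (w%:E + v%:E))); last first.
  rewrite lee_pmul2l ?lte_fin// leeD2r// /w -nsy EFinM.
  by rewrite lee_pmul2l ?lte_fin// far// nsy ltW.
have w0 : (0 <= w)%R by rewrite mulr_ge0 ?powR_ge0.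
apply: (@le_trans _ _ (s%:E * (v%:E `^ B * w%:E `^ (1 - B)))); last first.
  rewrite lee_pmul2l ?lte_fin// addeC; apply: geometric_mean_le_add; rewrite ?lee_fin//.
  by apply/andP; split; lra.
rewrite !poweR_EFin -!EFinM lee_fin /w powRM ?powR_ge0//.
rewrite -powRrM [(- b * _)%R](_ : _ = t - 1)%R; last by rewrite /b; field; lra.
rewrite powRM//.
have -> : (s `^ A = s * s `^ (1 - B) * s `^ (t - 1))%R.
  rewrite -[X in (_ = X * _ * _)%R]powRr1// -!powRD; try by apply/implyP => _; rewrite gt_eqF.
  by congr (_ `^ _)%R; lra.
by rewrite le_eqVlt; apply/orP; left; apply/eqP; ring.
Qed.

End hls_pointwise.

Section hls_line.
Context (R : realType).
Local Open Scope ereal_scope.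
Local Notation mu := (@lebesgue_measure R).

Lemma measurable_affine_comp (f : R -> \bar R) (s : R) :
  measurable_fun [set: R] f ->
  measurable_fun [set: R * R] (fun z => f (z.2 + s * z.1)%R).
Proof.
move=> mf; apply: (measurableT_comp mf); apply: measurable_funD => //.
exact: measurable_funM.
Qed.

Lemma measurable_schur d (T : measurableType d) (kappa : R -> \bar R)
    (u v : T -> \bar R) (y : T -> R) :
  measurable_fun [set: R] kappa ->
  measurable_fun [set: T] u -> measurable_fun [set: T] v ->
  measurable_fun [set: T] y ->
  measurable_fun [set: T] (fun z => schur kappa (u z) (v z) (y z)).
Proof.
move=> mk mu_ mv my; apply: emeasurable_funM => //; apply: emeasurable_funD => //.
apply: emeasurable_funM => //; apply: (measurableT_comp mk).
apply: measurable_funM => //.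
by apply: (measurableT_comp (fine_measurable measurableT)).
Qed.

(** After a translation in [x], the integral in [y] for fixed [x] is at most
    [phi x] times a constant; the bound on [|s' - s|] controls the Jacobian of
    [y |-> psi (x + (s' - s) y)]. *)
Lemma integral_schur_le (kappa : R -> \bar R) (K : R) (phi psi : R -> \bar R)
    (s s' : R) :
  measurable_fun [set: R] kappa -> (forall z, 0 <= kappa z) ->
  \int[mu]_z kappa z <= K%:E ->
  measurable_fun [set: R] phi -> measurable_fun [set: R] psi ->
  (forall x, 0 <= phi x) -> (forall x, 0 <= psi x) ->
  \int[mu]_x phi x <= 1 -> \int[mu]_x psi x <= 1 ->
  (2^-1 <= `|s' - s|)%R ->
  \int[mu]_y \int[mu]_x schur kappa (phi (x + s * y)%R) (psi (x + s' * y)%R) y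
    <= (K + 2)%:E.
Proof.
move=> mk k0 kK mphi mpsi phi0 psi0 iphi ipsi ss.
set delta := (s' - s)%R in ss.
have d0 : (delta != 0)%R by rewrite -normr_gt0; lra.
have shiftE y : \int[mu]_x schur kappa (phi (x + s * y)%R) (psi (x + s' * y)%R) y =
    \int[mu]_x schur kappa (phi x) (psi (x + delta * y)%R) y.
  rewrite -(@ge0_integral_shift _ (fun x => schur kappa (phi x) (psi (x + delta * y)%R) y) (s * y)).
  - by apply: eq_integral => x _; congr schur; congr psi; rewrite /delta; ring.
  - apply: measurable_schur => //.
    by apply: (measurableT_comp mpsi); exact: measurable_funD.
  - by move=> x; exact: schur_ge0.
under eq_integral do rewrite shiftE.
have := @fubini_tonelli _ _ _ _ R mu mu (fun z : R * R =>
  schur kappa (phi z.2) (psi (z.2 + delta * z.1)%R) z.1).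
move=> /= ->; last 2 first.
- apply: measurable_schur => //; first exact: (measurableT_comp mphi).
  exact: measurable_affine_comp.
- by move=> z; exact: schur_ge0.
have K0 : (0 <= K)%R.
  by rewrite -lee_fin (le_trans _ kK)// integral_ge0.
apply: (@le_trans _ _ (\int[mu]_x (phi x * (K + 2)%:E))); last first.
  rewrite ge0_integralZr ?lee_fin//; last by rewrite addr_ge0.
  by rewrite -[leRHS]mul1e lee_wpmul2r// lee_fin addr_ge0.
apply: le_integral_nonmeasurable.
  by move=> x _; apply: integral_ge0 => y _; exact: schur_ge0.
move=> x _ /=.
have mpsid : measurable_fun [set: R] (fun y => psi (x + delta * y)%R).
  by apply: (measurableT_comp mpsi); exact: measurable_funD.
have mk' : measurable_fun [set: R] (fun y => phi x * kappa (fine (phi x) * y)%R).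
  apply: emeasurable_funM => //; apply: (measurableT_comp mk).
  exact: measurable_funM.
have kk0 y : 0 <= phi x * kappa (fine (phi x) * y)%R by rewrite mule_ge0.
rewrite /schur ge0_integralZl//; last 2 first.
  exact: emeasurable_funD.
  by move=> y _; rewrite adde_ge0.
have [px0|px0] := eqVneq (phi x) 0; first by rewrite px0 !mul0e.
have {}px0 : 0 < phi x by rewrite lt_def px0 phi0.
have [pxy|pxy] := eqVneq (phi x) +oo.
  by rewrite pxy [leRHS]gt0_mulye ?leey// lte_fin; lra.
apply: lee_pmul => //.
  by apply: integral_ge0 => y _; rewrite adde_ge0.
rewrite ge0_integralD// EFinD; apply: leeD.
  rewrite ge0_integralZl//; last first.
    by apply: (measurableT_comp mk); exact: measurable_funM.
  have : phi x \is a fin_num by rewrite fin_numE pxy gt_eqF// (lt_trans _ px0).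
  case: (phi x) px0 => [r| |]//; rewrite lte_fin => r0 _ /=.
  rewrite ge0_integral_scale ?gt_eqF//.
  by rewrite gtr0_norm// muleA -EFinM divff ?gt_eqF// mul1e.
have mpsix : measurable_fun [set: R] (fun z => psi (z + x)%R).
  by apply: (measurableT_comp mpsi); exact: measurable_funD.
under eq_integral do rewrite addrC.
rewrite (@ge0_integral_scale R (fun z => psi (z + x)%R) delta d0)//.
rewrite ge0_integral_shift// -[leRHS]mule1; apply: lee_pmul => //.
  exact: integral_ge0.
by rewrite lee_fin invf_ple ?posrE ?normr_gt0//; lra.
Qed.

(** The plane is covered by the regions where one of the two values dominates the
    other; in each, the point that carries the larger value is fixed first.
    The constant depends on [s] and [s'] only through the lower bound 1/2 on
    their distance. *)
Lemma hls_line (t A B : R) : (0 < t < 1)%R -> (A < 1)%R -> (B < 1)%R ->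
  (A + B = 1 + t)%R ->
  exists C : R, (0 < C)%R /\
  forall phi psi : R -> \bar R,
    measurable_fun [set: R] phi -> measurable_fun [set: R] psi ->
    (forall x, 0 <= phi x) -> (forall x, 0 <= psi x) ->
    \int[mu]_x phi x <= 1 -> \int[mu]_x psi x <= 1 ->
  forall s s' : R, (2^-1 <= `|s' - s|)%R ->
  \int[mu]_y \int[mu]_x
     (phi (x + s * y)%R `^ A * psi (x + s' * y)%R `^ B * riesz t y) <= C%:E.
Proof.
move=> t01 A1 B1 AB; have /andP[t0 t1] := t01.
have [|k1 [K1 [mk1 k10 [k1z near1] far1 kK1]]] :=
  @power_majorant R t ((1 - t) / (1 - B)) t01.
  by rewrite ltr_pdivlMr; lra.
have [|k2 [K2 [mk2 k20 [k2z near2] far2 kK2]]] :=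
  @power_majorant R t ((1 - t) / (1 - A)) t01.
  by rewrite ltr_pdivlMr; lra.
have K10 : (0 <= K1)%R by rewrite -lee_fin (le_trans _ kK1)// integral_ge0.
have K20 : (0 <= K2)%R by rewrite -lee_fin (le_trans _ kK2)// integral_ge0.
exists ((K1 + 2) + (K2 + 2))%R; split; first lra.
move=> phi psi mphi mpsi phi0 psi0 iphi ipsi s s' ss.
have m1 : measurable_fun [set: R * R] (fun z : R * R =>
    schur k1 (phi (z.2 + s * z.1)%R) (psi (z.2 + s' * z.1)%R) z.1).
  by apply: measurable_schur => //; exact: measurable_affine_comp.
have m2 : measurable_fun [set: R * R] (fun z : R * R =>
    schur k2 (psi (z.2 + s' * z.1)%R) (phi (z.2 + s * z.1)%R) z.1).
  by apply: measurable_schur => //; exact: measurable_affine_comp.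
have i1 := integral_schur_le mk1 k10 kK1 mphi mpsi phi0 psi0 iphi ipsi ss.
have i2 := integral_schur_le mk2 k20 kK2 mpsi mphi psi0 phi0 ipsi iphi.
have {}i2 := i2 s' s; rewrite distrC in i2; have {}i2 := i2 ss.
rewrite EFinD; apply: le_trans (leeD i1 i2).
rewrite -ge0_integralD//; last 4 first.
- by move=> y _; apply: integral_ge0 => x _; exact: schur_ge0.
- apply: (@measurable_fun_fubini_tonelli_F _ _ _ _ R mu _ m1).
  by move=> z; exact: schur_ge0.
- by move=> y _; apply: integral_ge0 => x _; exact: schur_ge0.
- apply: (@measurable_fun_fubini_tonelli_F _ _ _ _ R mu _ m2).
  by move=> z; exact: schur_ge0.
apply: le_integral_nonmeasurable => y _.
  by apply: integral_ge0 => x _; rewrite mule_ge0 ?riesz_ge0// mule_ge0 ?poweR_ge0.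
rewrite -ge0_integralD//; last 4 first.
- by move=> x _; exact: schur_ge0.
- apply: measurable_schur => //.
    by apply: (measurableT_comp mphi); exact: measurable_funD.
  by apply: (measurableT_comp mpsi); exact: measurable_funD.
- by move=> x _; exact: schur_ge0.
- apply: measurable_schur => //.
    by apply: (measurableT_comp mpsi); exact: measurable_funD.
  by apply: (measurableT_comp mphi); exact: measurable_funD.
apply: le_integral_nonmeasurable => x _.
  by rewrite mule_ge0 ?riesz_ge0// mule_ge0 ?poweR_ge0.
have [h|/ltW h] := leP (psi (x + s' * y)%R) (phi (x + s * y)%R).
  apply: (@le_trans _ _ (schur k1 (phi (x + s * y)%R) (psi (x + s' * y)%R) y)).
    exact: (le_schur _ t01 A1 B1 AB k10 k1z near1 far1).
  by rewrite leeDl//; exact: schur_ge0.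
apply: (@le_trans _ _ (schur k2 (psi (x + s' * y)%R) (phi (x + s * y)%R) y)).
  rewrite (muleC (phi _ `^ _)).
  by apply: (le_schur _ t01 B1 A1 _ k20 k2z near2 far2) => //; rewrite addrC.
by rewrite leeDr//; exact: schur_ge0.
Qed.

End hls_line.

(** * The trilinear form on the line *)

Section trilinear_line.
Context (R : realType).
Local Open Scope ereal_scope.
Local Notation mu := (@lebesgue_measure R).

(** The trilinear product is a geometric mean, with weights [l] and [1 - l], of
    two bilinear products that share the factor [u]. *)
Lemma bilinear_split (a b c A A' B C l : R) (u v w : \bar R) :
  (0 < l < 1)%R -> (0 < a)%R ->
  (l * A + (1 - l) * A' = a)%R -> (B * l = b)%R -> (C * (1 - l) = c)%R ->
  0 <= u -> 0 <= v -> 0 <= w ->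
  u `^ a * v `^ b * w `^ c <= u `^ A * v `^ B + u `^ A' * w `^ C.
Proof.
move=> /andP[l0 l1] a0 aE bE cE u0 v0 w0.
have := @geometric_mean_le_add R l (u `^ A * v `^ B) (u `^ A' * w `^ C).
rewrite (ltW l0) (ltW l1) => /(_ isT) h.
apply: le_trans (h _ _); rewrite ?mule_ge0 ?poweR_ge0//.
rewrite !poweRM ?poweR_ge0// -!poweRrM bE cE -aE poweRD; last first.
  by apply: add_neq0_poweRD_def; rewrite aE gt_eqF.
rewrite (mulrC l) (mulrC (1 - l)%R).
by rewrite le_eqVlt; apply/orP; left; apply/eqP; rewrite muleACA muleA.
Qed.

Lemma measurable_poweR_comp d (T : measurableType d) (f : T -> \bar R) (a : R) :
  measurable_fun [set: T] f -> measurable_fun [set: T] (fun x => f x `^ a).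
Proof. by move=> mf; apply: (measurableT_comp (measurable_poweR a)). Qed.

(** The conditions say that both exponents [b / l] and [c / (1 - l)] of the two
    bilinear products lie strictly between [t] and 1.  The interval that they leave
    for [l] is nonempty exactly because [t < a < 1]. *)
Lemma interpolation_weight (t a b c : R) :
  (0 < t < 1)%R -> (t < a < 1)%R -> (0 < b)%R -> (0 < c)%R ->
  (a + b + c = 1 + t)%R ->
  exists l, [/\ (0 < l < 1)%R, (b < l < b / t)%R & (c < 1 - l < c / t)%R].
Proof.
move=> /andP[t0 t1] /andP[ta a1] b0 c0 abc.
have bt : (b < b / t)%R by rewrite ltr_pdivlMr// gtr_pMr.
have ct : (c < c / t)%R by rewrite ltr_pdivlMr// gtr_pMr.
have bct : (1 < b / t + c / t)%R by rewrite -mulrDl ltr_pdivlMr//; lra.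
(* The conditions read [lo < l < hi]; the midpoint is a solution. *)
pose lo := Num.max b (1 - c / t)%R; pose hi := Num.min (1 - c)%R (b / t)%R.
have lohi : (lo < hi)%R.
  by rewrite lt_min !gt_max; apply/andP; split; apply/andP; split; lra.
have [lo1 lo2] : (b <= lo /\ 1 - c / t <= lo)%R.
  by split; rewrite le_max lexx ?orbT.
have [hi1 hi2] : (hi <= 1 - c /\ hi <= b / t)%R.
  by split; rewrite ge_min lexx ?orbT.
by exists ((lo + hi) / 2)%R; split; apply/andP; split; lra.
Qed.

(** The first point has to be far from the two others, since the two bilinear
    products pair it with each of them. *)
Lemma trilinear_line_core (t a b c : R) :
  (0 < t < 1)%R -> (t < a < 1)%R -> (0 < b)%R -> (0 < c)%R ->
  (a + b + c = 1 + t)%R ->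
  exists C : R, (0 < C)%R /\
  forall phi psi eta : R -> \bar R,
    measurable_fun [set: R] phi -> measurable_fun [set: R] psi ->
    measurable_fun [set: R] eta ->
    (forall x, 0 <= phi x) -> (forall x, 0 <= psi x) -> (forall x, 0 <= eta x) ->
    \int[mu]_x phi x <= 1 -> \int[mu]_x psi x <= 1 -> \int[mu]_x eta x <= 1 ->
  forall s1 s2 s3 : R, (2^-1 <= `|s2 - s1|)%R -> (2^-1 <= `|s3 - s1|)%R ->
  \int[mu]_y \int[mu]_x
     (phi (x + s1 * y)%R `^ a * psi (x + s2 * y)%R `^ b *
      eta (x + s3 * y)%R `^ c * riesz t y) <= C%:E.
Proof.
move=> t01 ta b0 c0 abc; have /andP[t0 t1] := t01; have /andP[ta' a1] := ta.
have [l [l01 /andP[bl lb] /andP[cl lc]]] := interpolation_weight t01 ta b0 c0 abc.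
have /andP[l0 l1] := l01.
have l1' : (0 < 1 - l)%R by lra.
pose B := (b / l)%R; pose G := (c / (1 - l))%R.
have B1 : (B < 1)%R by rewrite ltr_pdivrMr// mul1r.
have G1 : (G < 1)%R by rewrite ltr_pdivrMr// mul1r.
have tB : (t < B)%R by rewrite ltr_pdivlMr// mulrC -ltr_pdivlMr.
have tG : (t < G)%R by rewrite ltr_pdivlMr// mulrC -ltr_pdivlMr.
have [|||C1 [C10 H1]] := @hls_line R t (1 + t - B)%R B t01; [lra|lra|lra|].
have [|||C2 [C20 H2]] := @hls_line R t (1 + t - G)%R G t01; [lra|lra|lra|].
exists (C1 + C2)%R; split; first lra.
move=> phi psi eta mphi mpsi meta phi0 psi0 eta0 iphi ipsi ieta s1 s2 s3 s12 s13.
have {}H1 := H1 _ _ mphi mpsi phi0 psi0 iphi ipsi _ _ s12.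
have {}H2 := H2 _ _ mphi meta phi0 eta0 iphi ieta _ _ s13.
rewrite EFinD; apply: le_trans (leeD H1 H2).
have mpair (f g : R -> \bar R) A A' s s' : measurable_fun [set: R] f ->
    measurable_fun [set: R] g ->
    measurable_fun [set: R * R] (fun z : R * R =>
      f (z.2 + s * z.1)%R `^ A * g (z.2 + s' * z.1)%R `^ A' * riesz t z.1).
  move=> mf mg; apply: emeasurable_funM; last first.
    exact: (measurableT_comp (measurable_riesz t)).
  by apply: emeasurable_funM; apply: measurable_poweR_comp; exact: measurable_affine_comp.
have mline (f g : R -> \bar R) A A' s s' (y : R) : measurable_fun [set: R] f ->
    measurable_fun [set: R] g ->
    measurable_fun [set: R] (fun x : R =>
      f (x + s * y)%R `^ A * g (x + s' * y)%R `^ A' * riesz t y).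
  move=> mf mg; apply: emeasurable_funM => //.
  apply: emeasurable_funM; apply: measurable_poweR_comp.
    by apply: (measurableT_comp mf); exact: measurable_funD.
  by apply: (measurableT_comp mg); exact: measurable_funD.
have pos (u v : \bar R) A A' y : 0 <= u `^ A * v `^ A' * riesz t y.
  by rewrite mule_ge0 ?riesz_ge0// mule_ge0 ?poweR_ge0.
rewrite -ge0_integralD//; last 4 first.
- by move=> y _; apply: integral_ge0 => x _; exact: pos.
- exact: (@measurable_fun_fubini_tonelli_F _ _ _ _ R mu _ (mpair _ _ _ _ _ _ mphi mpsi)).
- by move=> y _; apply: integral_ge0 => x _; exact: pos.
- exact: (@measurable_fun_fubini_tonelli_F _ _ _ _ R mu _ (mpair _ _ _ _ _ _ mphi meta)).
apply: le_integral_nonmeasurable => y _.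
  apply: integral_ge0 => x _; rewrite mule_ge0 ?riesz_ge0//.
  by rewrite mule_ge0 ?poweR_ge0// mule_ge0 ?poweR_ge0.
rewrite -ge0_integralD//; [|exact: mline..].
apply: le_integral_nonmeasurable => x _.
  rewrite mule_ge0 ?riesz_ge0//.
  by rewrite mule_ge0 ?poweR_ge0// mule_ge0 ?poweR_ge0.
rewrite -ge0_muleDl ?mule_ge0 ?poweR_ge0// lee_wpmul2r ?riesz_ge0//.
apply: (bilinear_split l01) => //.
- lra.
- have -> : a = (1 + t - b - c)%R by lra.
  by rewrite /B /G; field; apply/andP; split; rewrite gt_eqF.
- by rewrite /B divfK// gt_eqF.
- by rewrite /G divfK// gt_eqF.
Qed.

(** Of the points [x + (theta-1) y] and [x + theta y], at least one lies at
    distance [|y| / 2] or more from [x], and they are at distance [|y|] from each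
    other: that point plays the role of the first point above.  This is where the
    constant becomes independent of [theta], and why both [t < a] and [t < b]
    are required. *)
Lemma trilinear_line_unit (t a b c : R) :
  (0 < t < 1)%R -> (t < a < 1)%R -> (t < b < 1)%R -> (0 <= c)%R ->
  (a + b + c = 1 + t)%R ->
  exists C : R, (0 < C)%R /\
  forall phi psi eta : R -> \bar R,
    measurable_fun [set: R] phi -> measurable_fun [set: R] psi ->
    measurable_fun [set: R] eta ->
    (forall x, 0 <= phi x) -> (forall x, 0 <= psi x) -> (forall x, 0 <= eta x) ->
    \int[mu]_x phi x <= 1 -> \int[mu]_x psi x <= 1 -> \int[mu]_x eta x <= 1 ->
  forall theta : R,
  \int[mu]_y \int[mu]_x
     (phi (x + (theta - 1) * y)%R `^ a * psi (x + theta * y)%R `^ b *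
      eta x `^ c * riesz t y) <= C%:E.
Proof.
move=> t01 ta tb c0 abc; have /andP[t0 t1] := t01.
have /andP[ta' a1] := ta; have /andP[tb' b1] := tb.
move: c0; rewrite le_eqVlt => /predU1P[c0|c0].
  have [|C [C0 H]] := @hls_line R t a b t01 a1 b1; first lra.
  exists C; split=> // phi psi eta mphi mpsi _ phi0 psi0 _ iphi ipsi _ theta.
  subst c; under eq_integral do under eq_integral do rewrite poweRe0 mule1.
  apply: H => //; rewrite (_ : (_ - _)%R = 1%R); last by ring.
  by rewrite normr1; lra.
have [|C1 [C10 H1]] := @trilinear_line_core t a b c t01 ta _ c0 abc; first lra.
have [||C2 [C20 H2]] := @trilinear_line_core t b a c t01 tb _ c0; [lra|lra|].
exists (C1 + C2)%R; split; first lra.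
move=> phi psi eta mphi mpsi meta phi0 psi0 eta0 iphi ipsi ieta theta.
have [th|th] := leP (2^-1)%R `|theta - 1|%R.
  apply: (@le_trans _ _ C1%:E); last by rewrite lee_fin; lra.
  have := H1 _ _ _ mphi mpsi meta phi0 psi0 eta0 iphi ipsi ieta (theta - 1)%R theta 0%R.
  under eq_integral do under eq_integral do rewrite mul0r addr0.
  apply.
    by rewrite (_ : (_ - _)%R = 1%R); [rewrite normr1; lra|ring].
  by rewrite sub0r normrN.
apply: (@le_trans _ _ C2%:E); last by rewrite lee_fin; lra.
have := H2 _ _ _ mpsi mphi meta psi0 phi0 eta0 ipsi iphi ieta theta (theta - 1)%R 0%R.
under eq_integral do under eq_integral do rewrite mul0r addr0 (muleC (psi _ `^ _)).
apply.
  by rewrite (_ : (_ - _)%R = (- 1)%R); [rewrite normrN1; lra|ring].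
rewrite sub0r normrN ger0_norm; move: th; rewrite ltr_norml => /andP[]; lra.
Qed.

End trilinear_line.

Section trilinear_line_scaled.
Context (R : realType).
Local Open Scope ereal_scope.
Local Notation mu := (@lebesgue_measure R).

(** Functions of integral zero cannot be normalized; they make the form vanish. *)
Lemma integral_poweR_mul_eq0 d (T : measurableType d)
    (m : {measure set T -> \bar R}) (a : R) (f g : T -> \bar R) :
  (a != 0)%R -> measurable_fun [set: T] f -> measurable_fun [set: T] g ->
  (forall x, 0 <= f x) -> (forall x, 0 <= g x) ->
  \int[m]_x f x = 0 -> \int[m]_x (f x `^ a * g x) = 0.
Proof.
move=> a0 mf mg f0 g0 if0.
have : \int[m]_x `|f x| = 0.
  by under eq_integral do rewrite gee0_abs//.
move/(ae_eq_integral_abs m measurableT mf) => f_ae0.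
rewrite (@ae_eq_integral _ _ _ m setT (cst 0))//.
- by rewrite integral0.
- by apply: emeasurable_funM => //; exact: measurable_poweR_comp.
- by apply: filterS f_ae0 => x /= /(_ Logic.I) fx _; rewrite fx poweR0r// mul0e.
Qed.

(** The normalized estimate is homogeneous of degree [a], [b], [c].  The
    degenerate cases matter: in the induction on the dimension the functions are
    slices, whose integrals may be zero or infinite. *)
Lemma trilinear_line (t a b c : R) :
  (0 < t < 1)%R -> (t < a < 1)%R -> (t < b < 1)%R -> (0 <= c)%R ->
  (a + b + c = 1 + t)%R ->
  exists C : R, (0 < C)%R /\
  forall phi psi eta : R -> \bar R,
    measurable_fun [set: R] phi -> measurable_fun [set: R] psi ->
    measurable_fun [set: R] eta ->
    (forall x, 0 <= phi x) -> (forall x, 0 <= psi x) -> (forall x, 0 <= eta x) ->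
  forall theta : R,
  \int[mu]_y \int[mu]_x
     (phi (x + (theta - 1) * y)%R `^ a * psi (x + theta * y)%R `^ b *
      eta x `^ c * riesz t y)
  <= C%:E * (\int[mu]_x phi x) `^ a * (\int[mu]_x psi x) `^ b *
     (\int[mu]_x eta x) `^ c.
Proof.
move=> t01 ta tb c0 abc; have /andP[t0 t1] := t01.
have /andP[ta' a1] := ta; have /andP[tb' b1] := tb.
have a0 : (a != 0)%R by rewrite gt_eqF//; lra.
have b0 : (b != 0)%R by rewrite gt_eqF//; lra.
have [C [C0 H]] := trilinear_line_unit t01 ta tb c0 abc.
exists C; split=> // phi psi eta mphi mpsi meta phi0 psi0 eta0 theta.
have mline (f : R -> \bar R) A s (y : R) : measurable_fun [set: R] f ->
    measurable_fun [set: R] (fun x : R => f (x + s * y)%R `^ A).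
  move=> mf; apply: measurable_poweR_comp.
  by apply: (measurableT_comp mf); exact: measurable_funD.
have shift0 (f : R -> \bar R) s y : measurable_fun [set: R] f -> (forall x, 0 <= f x) ->
    \int[mu]_x f x = 0 -> \int[mu]_x f (x + s * y)%R = 0.
  by move=> mf f0; rewrite ge0_integral_shift.
have mshift (f : R -> \bar R) s y : measurable_fun [set: R] f ->
    measurable_fun [set: R] (fun x : R => f (x + s * y)%R).
  by move=> mf; apply: (measurableT_comp mf); exact: measurable_funD.
set I := (X in X <= _).
have zero1 : \int[mu]_x phi x = 0 -> I = 0.
  move=> i0; apply: integral0_eq => y _.
  under eq_integral do rewrite -!muleA.
  apply: integral_poweR_mul_eq0 => //; [exact: mshift| | |exact: shift0].
  - apply: emeasurable_funM; first exact: mline.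
    by apply: emeasurable_funM => //; exact: measurable_poweR_comp.
  - by move=> x; rewrite !mule_ge0 ?poweR_ge0 ?riesz_ge0.
have zero2 : \int[mu]_x psi x = 0 -> I = 0.
  move=> i0; apply: integral0_eq => y _.
  under eq_integral do rewrite (muleC (phi _ `^ _)) -!muleA.
  apply: integral_poweR_mul_eq0 => //; [exact: mshift| | |exact: shift0].
  - apply: emeasurable_funM; first exact: mline.
    by apply: emeasurable_funM => //; exact: measurable_poweR_comp.
  - by move=> x; rewrite !mule_ge0 ?poweR_ge0 ?riesz_ge0.
have zero3 : (c != 0)%R -> \int[mu]_x eta x = 0 -> I = 0.
  move=> c0' i0; apply: integral0_eq => y _.
  under eq_integral do rewrite (muleC _ (eta _ `^ _)) -!muleA.
  apply: integral_poweR_mul_eq0 => //.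
  - apply: emeasurable_funM; first exact: mline.
    by apply: emeasurable_funM => //; exact: mline.
  - by move=> x; rewrite !mule_ge0 ?poweR_ge0 ?riesz_ge0.
have RHS0 : 0 <= C%:E * (\int[mu]_x phi x) `^ a * (\int[mu]_x psi x) `^ b *
     (\int[mu]_x eta x) `^ c.
  by rewrite !mule_ge0 ?poweR_ge0// lee_fin ltW.
have [i1|i1] := eqVneq (\int[mu]_x phi x) 0; first by rewrite zero1.
have [i2|i2] := eqVneq (\int[mu]_x psi x) 0; first by rewrite zero2.
have pos1 : 0 < \int[mu]_x phi x by rewrite lt_def i1 integral_ge0.
have pos2 : 0 < \int[mu]_x psi x by rewrite lt_def i2 integral_ge0.
(* [zeta] stands for [eta], except that when [c = 0] it is replaced by 0, whose
   integral is below any [M3]. *)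
have scaled (zeta : R -> \bar R) (M1 M2 M3 : R) : measurable_fun [set: R] zeta ->
    (forall x, 0 <= zeta x) -> (0 < M1)%R -> (0 < M2)%R -> (0 < M3)%R ->
    (forall x, eta x `^ c = zeta x `^ c) ->
    \int[mu]_x phi x <= M1%:E -> \int[mu]_x psi x <= M2%:E ->
    \int[mu]_x zeta x <= M3%:E ->
    I <= C%:E * M1%:E `^ a * M2%:E `^ b * M3%:E `^ c.
  move=> mz z0 M10 M20 M30 ez j1 j2 j3.
  have rescale (f : R -> \bar R) (M A : R) (x : R) : (forall x, 0 <= f x) ->
      (0 < M)%R -> f x `^ A = M%:E `^ A * (M^-1%:E * f x) `^ A.
    move=> f0 M0; rewrite -poweRM; last 2 first.
    - by rewrite lee_fin ltW.
    - by rewrite mule_ge0// lee_fin invr_ge0 ltW.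
    by rewrite muleA -EFinM divff ?gt_eqF// mul1e.
  have unit_ (f : R -> \bar R) (M : R) : measurable_fun [set: R] f ->
      (forall x, 0 <= f x) -> (0 < M)%R -> \int[mu]_x f x <= M%:E ->
      \int[mu]_x (M^-1%:E * f x) <= 1.
    move=> mf f0 M0 fM; rewrite ge0_integralZl//; last by rewrite lee_fin invr_ge0 ltW.
    apply: (@le_trans _ _ (M^-1%:E * M%:E)).
      by rewrite lee_wpmul2l// lee_fin invr_ge0 ltW.
    by rewrite -EFinM mulVf// gt_eqF.
  have msc (f : R -> \bar R) (M : R) : measurable_fun [set: R] f ->
      measurable_fun [set: R] (fun x => M^-1%:E * f x).
    by move=> mf; exact: emeasurable_funM.
  have sc0 (f : R -> \bar R) (M : R) : (forall x, 0 <= f x) -> (0 < M)%R ->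
      forall x, 0 <= M^-1%:E * f x.
    by move=> f0 M0 x; rewrite mule_ge0// lee_fin invr_ge0 ltW.
  have := H _ _ _ (msc _ M1 mphi) (msc _ M2 mpsi) (msc _ M3 mz)
    (sc0 _ _ phi0 M10) (sc0 _ _ psi0 M20) (sc0 _ _ z0 M30)
    (unit_ _ _ mphi phi0 M10 j1) (unit_ _ _ mpsi psi0 M20 j2)
    (unit_ _ _ mz z0 M30 j3) theta.
  set J := (X in X <= _) => JC.
  suff -> : I = (M1%:E `^ a * M2%:E `^ b * M3%:E `^ c) * J.
    rewrite -(muleA C%:E) -(muleA C%:E) (muleC C%:E).
    by rewrite lee_wpmul2l// !mule_ge0 ?poweR_ge0.
  rewrite /J -ge0_integralZl//; last 3 first.
  - apply: (@measurable_fun_fubini_tonelli_F _ _ _ _ R mu (fun z : R * R =>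
      (M1^-1%:E * phi (z.2 + (theta - 1) * z.1)%R) `^ a *
      (M2^-1%:E * psi (z.2 + theta * z.1)%R) `^ b *
      (M3^-1%:E * zeta z.2) `^ c * riesz t z.1)).
      apply: emeasurable_funM; last exact: (measurableT_comp (measurable_riesz t)).
      apply: emeasurable_funM; last first.
        apply: measurable_poweR_comp; apply: emeasurable_funM => //.
        exact: (measurableT_comp mz).
      by apply: emeasurable_funM; apply: measurable_poweR_comp;
        apply: emeasurable_funM => //; exact: measurable_affine_comp.
    by move=> z; rewrite !mule_ge0 ?poweR_ge0 ?riesz_ge0.
  - by move=> y _; apply: integral_ge0 => x _; rewrite !mule_ge0 ?poweR_ge0 ?riesz_ge0.
  - by rewrite !mule_ge0 ?poweR_ge0.
  rewrite /I; apply: eq_integral => y _.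
  rewrite -ge0_integralZl//; last 3 first.
  - apply: emeasurable_funM => //; apply: emeasurable_funM; last first.
      by apply: measurable_poweR_comp; exact: emeasurable_funM.
    by apply: emeasurable_funM; apply: measurable_poweR_comp;
        apply: emeasurable_funM => //; exact: mshift.
  - by move=> x _; rewrite !mule_ge0 ?poweR_ge0 ?riesz_ge0.
  - by rewrite !mule_ge0 ?poweR_ge0.
  apply: eq_integral => x _; rewrite ez.
  rewrite (rescale phi M1)// (rescale psi M2)// (rescale zeta M3)// !muleA.
  congr (_ * _); rewrite -!muleA; congr (_ * _).
  rewrite muleCA; congr (_ * _).
  by rewrite [RHS]muleCA; congr (_ * _); rewrite muleCA.
have pow_gt0 (x : \bar R) A : 0 < x -> 0 < x `^ A by exact: poweR_gt0.
have [j1|j1] := eqVneq (\int[mu]_x phi x) +oo.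
  rewrite j1 poweRyr// [C%:E * _]gt0_muley ?lte_fin//.
  rewrite [+oo * _]gt0_mulye ?pow_gt0//.
  have [->|c0'] := eqVneq c 0%R; first by rewrite poweRe0 mule1 leey.
  have [i3|i3] := eqVneq (\int[mu]_x eta x) 0.
    by rewrite zero3// i3 poweR0r// mule0.
  by rewrite gt0_mulye ?leey// pow_gt0// lt_def i3 integral_ge0.
have [j2|j2] := eqVneq (\int[mu]_x psi x) +oo.
  rewrite j2 poweRyr// [C%:E * _ * +oo]gt0_muley; last first.
    by rewrite mule_gt0 ?lte_fin ?pow_gt0.
  have [->|c0'] := eqVneq c 0%R; first by rewrite poweRe0 mule1 leey.
  have [i3|i3] := eqVneq (\int[mu]_x eta x) 0.
    by rewrite zero3// i3 poweR0r// mule0.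
  by rewrite gt0_mulye ?leey// pow_gt0// lt_def i3 integral_ge0.
have f1 : \int[mu]_x phi x \is a fin_num by rewrite fin_numE j1 gt_eqF// (lt_trans _ pos1).
have f2 : \int[mu]_x psi x \is a fin_num by rewrite fin_numE j2 gt_eqF// (lt_trans _ pos2).
rewrite -[X in _ * X `^ a](fineK f1) -[X in _ * X `^ b * _](fineK f2).
have fp1 : (0 < fine (\int[mu]_x phi x))%R by rewrite -lte_fin fineK.
have fp2 : (0 < fine (\int[mu]_x psi x))%R by rewrite -lte_fin fineK.
have [c00|c0'] := eqVneq c 0%R.
  have := scaled (cst 0) _ _ 1%R (measurable_cst _) (fun=> lexx _) fp1 fp2 ltr01.
  rewrite c00 !poweRe0; apply.
  - by move=> x; rewrite !poweRe0.
  - by rewrite fineK.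
  - by rewrite fineK.
  - by rewrite integral0.
have [i3|i3] := eqVneq (\int[mu]_x eta x) 0.
  by rewrite zero3// !mule_ge0 ?poweR_ge0// lee_fin ltW.
have pos3 : 0 < \int[mu]_x eta x by rewrite lt_def i3 integral_ge0.
have [j3|j3] := eqVneq (\int[mu]_x eta x) +oo.
  rewrite j3 poweRyr// [leRHS]gt0_muley ?leey//.
  by rewrite !mule_gt0 ?lte_fin ?powR_gt0.
have f3 : \int[mu]_x eta x \is a fin_num by rewrite fin_numE j3 gt_eqF// (lt_trans _ pos3).
rewrite -[X in _ * X `^ c](fineK f3).
have fp3 : (0 < fine (\int[mu]_x eta x))%R by rewrite -lte_fin fineK.
by apply: (scaled eta) => //; rewrite fineK.
Qed.

End trilinear_line_scaled.

(** * The trilinear form in dimension n *)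

Section euclidean_space.
Context (R : realType).
Local Open Scope ereal_scope.
Local Notation mu := (@lebesgue_measure R).

Lemma measurable_rV_affine d (T : measurableType d) n (x y : T -> 'rV[R]_n)
    (s : T -> R) :
  measurable_fun [set: T] x -> measurable_fun [set: T] y ->
  measurable_fun [set: T] s ->
  measurable_fun [set: T] (fun z => x z + s z *: y z)%R.
Proof.
move=> mx my ms; apply: measurable_fun_rV => i.
under eq_fun do rewrite !mxE.
apply: measurable_funD; first exact: (measurableT_comp (measurable_coord i)).
apply: measurable_funM => //.
exact: (measurableT_comp (measurable_coord i)).
Qed.

Lemma rV_cons_affine n (s x1 y1 : R) (x y : 'rV[R]_n) :
  (rV_cons (x1, x) + s *: rV_cons (y1, y) = rV_cons (x1 + s * y1, x + s *: y))%R.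
Proof.
apply/rowP => i; rewrite [LHS]mxE [X in (_ + X)%R]mxE.
have [->|[j ->]] : i = ord0 \/ exists j, i = lift ord0 j.
    by case: (unliftP ord0 i) => [j ->|->]; [right; exists j|left].
  by rewrite !rV_consEl.
by rewrite !rV_consEr [RHS]mxE [X in _ = (_ + X)%R]mxE.
Qed.

Lemma integral_rV0 (f : 'rV[R]_0 -> \bar R) :
  measurable_fun [set: 'rV[R]_0] f -> \int[lebesgue_rV 0]_x f x = f 0%R.
Proof. by move=> mf; rewrite integral_dirac// diracT mul1e. Qed.

Lemma ge0_integral_rV_succ n (f : 'rV[R]_n.+1 -> \bar R) :
  measurable_fun [set: 'rV[R]_n.+1] f -> (forall x, 0 <= f x) ->
  \int[lebesgue_rV n.+1]_x f x =
  \int[lebesgue_rV n]_x \int[mu]_s f (rV_cons (s, x)).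
Proof.
move=> mf f0.
pose T1 := measurableTypeR R.
have mc : measurable_fun [set: T1 * 'rV[R]_n] (@rV_cons R n) by exact: measurable_rV_cons.
have := @ge0_integral_pushforward _ _ (T1 * 'rV[R]_n)%type _ R (@rV_cons R n) mc
  (mu \x lebesgue_rV n) setT f measurableT mf (fun y _ => f0 y).
rewrite preimage_setT.
rewrite (@fubini_tonelli2 _ _ _ _ R mu (lebesgue_rV n) (f \o @rV_cons R n)) //.
  exact: (measurableT_comp mf mc).
by move=> z; exact: f0.
Qed.


Definition riesz_rV (t : R) n (y : 'rV[R]_n) : \bar R :=
  \big[*%E/1%E]_(i < n) riesz t (y ord0 i).

Lemma riesz_rV_ge0 t n (y : 'rV[R]_n) : 0 <= riesz_rV t y.
Proof.
apply: (big_ind (fun u : \bar R => 0 <= u)) => // [u v u0 v0|i _].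
  exact: mule_ge0.
exact: riesz_ge0.
Qed.

Lemma riesz_rV_cons t n s (y : 'rV[R]_n) :
  riesz_rV t (rV_cons (s, y)) = riesz t s * riesz_rV t y.
Proof.
rewrite /riesz_rV big_ord_recl rV_consEl; congr (_ * _).
by apply: eq_bigr => i _; rewrite rV_consEr.
Qed.

Lemma measurable_riesz_rV t n : measurable_fun [set: 'rV[R]_n] (@riesz_rV t n).
Proof.
have H m (F : 'I_m -> 'rV[R]_n -> \bar R) :
    (forall i, measurable_fun [set: 'rV[R]_n] (F i)) ->
    measurable_fun [set: 'rV[R]_n] (fun y => \big[*%E/1%E]_(i < m) F i y).
  elim: m F => [|m IH] F mF.
    by under eq_fun do rewrite big_ord0; exact: measurable_cst.
  under eq_fun do rewrite big_ord_recl.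
  apply: emeasurable_funM => //; apply: (IH (fun i => F (lift ord0 i))) => i.
  exact: mF.
apply: (H n (fun i y => riesz t (y ord0 i))) => i.
exact: (measurableT_comp (measurable_riesz t) (measurable_coord i)).
Qed.

Definition trilinear_density (t a b c : R) n (phi psi eta : 'rV[R]_n -> \bar R)
    (theta : R) (y x : 'rV[R]_n) : \bar R :=
  phi (x + (theta - 1) *: y)%R `^ a * psi (x + theta *: y)%R `^ b *
  eta x `^ c * riesz_rV t y.

Lemma trilinear_density_ge0 t a b c n phi psi eta theta (y x : 'rV[R]_n) :
  0 <= trilinear_density t a b c phi psi eta theta y x.
Proof. by rewrite !mule_ge0 ?poweR_ge0 ?riesz_rV_ge0. Qed.

Lemma measurable_trilinear_density d (T : measurableType d) t a b c n
    (phi psi eta : 'rV[R]_n -> \bar R) (theta : T -> R) (y x : T -> 'rV[R]_n) :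
  measurable_fun [set: 'rV[R]_n] phi -> measurable_fun [set: 'rV[R]_n] psi ->
  measurable_fun [set: 'rV[R]_n] eta ->
  measurable_fun [set: T] theta -> measurable_fun [set: T] y ->
  measurable_fun [set: T] x ->
  measurable_fun [set: T]
    (fun z => trilinear_density t a b c phi psi eta (theta z) (y z) (x z)).
Proof.
move=> mphi mpsi meta mth my mx; apply: emeasurable_funM; last first.
  exact: (measurableT_comp (@measurable_riesz_rV t n)).
apply: emeasurable_funM; last first.
  by apply: measurable_poweR_comp; exact: (measurableT_comp meta).
apply: emeasurable_funM; apply: measurable_poweR_comp.
  apply: (measurableT_comp mphi).
  by apply: measurable_rV_affine => //; exact: measurable_funB.
by apply: (measurableT_comp mpsi); exact: measurable_rV_affine.
Qed.

(** Induction on [n]: for fixed values of the remaining coordinates of [x] and [y],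
    the estimate on the line applies to slices in the first coordinate.  The
    integrals of the slices appear with the exponents [a], [b], [c], hence form a
    trilinear density in one dimension less, and their own integrals are those of
    the original functions by Tonelli's theorem.  Each coordinate contributes one
    factor [C]. *)
Lemma trilinear_rV (t a b c : R) :
  (0 < t < 1)%R -> (t < a < 1)%R -> (t < b < 1)%R -> (0 <= c)%R ->
  (a + b + c = 1 + t)%R ->
  exists C : R, (0 < C)%R /\
  forall n (phi psi eta : 'rV[R]_n -> \bar R),
    measurable_fun [set: 'rV[R]_n] phi -> measurable_fun [set: 'rV[R]_n] psi ->
    measurable_fun [set: 'rV[R]_n] eta ->
    (forall x, 0 <= phi x) -> (forall x, 0 <= psi x) -> (forall x, 0 <= eta x) ->
  forall theta : R,
  \int[lebesgue_rV n]_y \int[lebesgue_rV n]_x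
     trilinear_density t a b c phi psi eta theta y x
  <= (C ^+ n)%:E * (\int[lebesgue_rV n]_x phi x) `^ a *
     (\int[lebesgue_rV n]_x psi x) `^ b * (\int[lebesgue_rV n]_x eta x) `^ c.
Proof.
move=> t01 ta tb c0 abc.
have [C [C0 H]] := trilinear_line t01 ta tb c0 abc.
exists C; split=> //; elim=> [|n IH] phi psi eta mphi mpsi meta phi0 psi0 eta0 theta.
  have m0 y : measurable_fun [set: 'rV[R]_0]
      (fun x => trilinear_density t a b c phi psi eta theta y x).
    exact: measurable_trilinear_density.
  rewrite integral_rV0//; last first.
    under eq_fun do rewrite integral_rV0//.
    exact: measurable_trilinear_density.
  rewrite !integral_rV0// expr0 mul1e /trilinear_density.
  by rewrite !scaler0 !addr0 /riesz_rV big_ord0 mule1.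
set D := trilinear_density t a b c phi psi eta theta.
pose Sphi (x : 'rV[R]_n) := \int[mu]_s phi (rV_cons (s, x)).
pose Spsi (x : 'rV[R]_n) := \int[mu]_s psi (rV_cons (s, x)).
pose Seta (x : 'rV[R]_n) := \int[mu]_s eta (rV_cons (s, x)).
pose T1 := measurableTypeR R.
have mcons : measurable_fun [set: T1 * 'rV[R]_n] (@rV_cons R n) by exact: measurable_rV_cons.
have mS (f : 'rV[R]_n.+1 -> \bar R) : measurable_fun [set: 'rV[R]_n.+1] f ->
    (forall x, 0 <= f x) ->
    measurable_fun [set: 'rV[R]_n] (fun x => \int[mu]_s f (rV_cons (s, x))).
  move=> mf f0.
  apply: (@measurable_fun_fubini_tonelli_G _ _ _ _ R mu (f \o @rV_cons R n)).
    exact: (measurableT_comp mf mcons).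
  by move=> z; exact: f0.
have mline (f : 'rV[R]_n.+1 -> \bar R) x : measurable_fun [set: 'rV[R]_n.+1] f ->
    measurable_fun [set: R] (fun s => f (rV_cons (s, x))).
  move=> mf; apply: (measurableT_comp mf); apply: (measurableT_comp mcons).
  exact: measurable_fun_pair.
have DE y1 x1 y x : D (rV_cons (y1, y)) (rV_cons (x1, x)) =
    phi (rV_cons (x1 + (theta - 1) * y1, x + (theta - 1) *: y))%R `^ a *
    psi (rV_cons (x1 + theta * y1, x + theta *: y))%R `^ b *
    eta (rV_cons (x1, x)) `^ c * riesz t y1 * riesz_rV t y.
  by rewrite /D /trilinear_density !rV_cons_affine riesz_rV_cons muleA.
have slice y x :
    \int[mu]_y1 \int[mu]_x1 D (rV_cons (y1, y)) (rV_cons (x1, x)) <=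
    C%:E * trilinear_density t a b c Sphi Spsi Seta theta y x.
  pose p s := phi (rV_cons (s, x + (theta - 1) *: y))%R.
  pose q s := psi (rV_cons (s, x + theta *: y))%R.
  pose e s := eta (rV_cons (s, x)).
  pose E y1 x1 := p (x1 + (theta - 1) * y1)%R `^ a * q (x1 + theta * y1)%R `^ b *
    e x1 `^ c * riesz t y1.
  have E0 y1 x1 : 0 <= E y1 x1 by rewrite !mule_ge0 ?poweR_ge0 ?riesz_ge0.
  have mp : measurable_fun [set: R] p by exact: mline.
  have mq : measurable_fun [set: R] q by exact: mline.
  have me : measurable_fun [set: R] e by exact: mline.
  have mE : measurable_fun [set: R * R] (fun z : R * R => E z.1 z.2).
    apply: emeasurable_funM; last exact: (measurableT_comp (measurable_riesz t)).
    apply: emeasurable_funM; last first.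
      by apply: measurable_poweR_comp; exact: (measurableT_comp me).
    by apply: emeasurable_funM; apply: measurable_poweR_comp; exact: measurable_affine_comp.
  have := H p q e mp mq me (fun=> phi0 _) (fun=> psi0 _) (fun=> eta0 _) theta.
  move=> HE.
  have -> : \int[mu]_y1 \int[mu]_x1 D (rV_cons (y1, y)) (rV_cons (x1, x)) =
      (\int[mu]_y1 \int[mu]_x1 E y1 x1) * riesz_rV t y.
    rewrite -ge0_integralZr//; last 3 first.
    - exact: (@measurable_fun_fubini_tonelli_F _ _ _ _ R mu _ mE).
    - by move=> y1 _; exact: integral_ge0.
    - exact: riesz_rV_ge0.
    apply: eq_integral => y1 _; rewrite -ge0_integralZr ?riesz_rV_ge0//.
      by apply: eq_integral => x1 _; rewrite DE.
    apply: emeasurable_funM => //; apply: emeasurable_funM; last exact: measurable_poweR_comp.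
    apply: emeasurable_funM; apply: measurable_poweR_comp.
      by apply: (measurableT_comp mp); exact: measurable_funD.
    by apply: (measurableT_comp mq); exact: measurable_funD.
  apply: le_trans (lee_wpmul2r (riesz_rV_ge0 t y) HE) _.
  by rewrite /trilinear_density -!muleA.
have D0 y x : 0 <= D y x by exact: trilinear_density_ge0.
rewrite ge0_integral_rV_succ; last 2 first.
- apply: (@measurable_fun_fubini_tonelli_F _ _ _ _ R (lebesgue_rV n.+1) (fun z => D z.1 z.2)).
    exact: measurable_trilinear_density.
  by move=> z; exact: D0.
- by move=> y; exact: integral_ge0.
have -> : \int[lebesgue_rV n]_y \int[mu]_y1 \int[lebesgue_rV n.+1]_x D (rV_cons (y1, y)) x
  = \int[lebesgue_rV n]_y \int[lebesgue_rV n]_x \int[mu]_y1 \int[mu]_x1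
      D (rV_cons (y1, y)) (rV_cons (x1, x)).
  apply: eq_integral => y _.
  have mD : measurable_fun [set: (T1 * 'rV[R]_n) * T1]
      (fun z : (T1 * 'rV[R]_n) * T1 => D (rV_cons (z.1.1, y)) (rV_cons (z.2, z.1.2))).
    apply: measurable_trilinear_density => //.
      apply: (measurableT_comp mcons); apply: measurable_fun_pair => //.
      exact: (measurableT_comp measurable_fst).
    apply: (measurableT_comp mcons); apply: measurable_fun_pair => //.
    exact: (measurableT_comp measurable_snd).
  have mG := @measurable_fun_fubini_tonelli_F _ _ _ _ R mu _ mD (fun=> D0 _ _).
  have := @fubini_tonelli _ _ _ _ R mu (lebesgue_rV n) _ mG.
  rewrite /fubini_F/= => <-; last by move=> z; exact: integral_ge0.
  apply: eq_integral => y1 _; rewrite ge0_integral_rV_succ//.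
  exact: measurable_trilinear_density.
have mT : measurable_fun [set: 'rV[R]_n * 'rV[R]_n]
    (fun z => trilinear_density t a b c Sphi Spsi Seta theta z.1 z.2).
  by apply: measurable_trilinear_density => //; exact: mS.
have S0 y x : 0 <= trilinear_density t a b c Sphi Spsi Seta theta y x.
  exact: trilinear_density_ge0.
have := IH Sphi Spsi Seta (mS _ mphi phi0) (mS _ mpsi psi0) (mS _ meta eta0).
move=> /(_ _ _ _ theta).
rewrite /Sphi /Spsi /Seta -!ge0_integral_rV_succ// -/Sphi -/Spsi -/Seta => IHn.
apply: (@le_trans _ _ (C%:E * \int[lebesgue_rV n]_y \int[lebesgue_rV n]_x
    trilinear_density t a b c Sphi Spsi Seta theta y x)); last first.
  rewrite exprS EFinM -!muleA lee_wpmul2l ?lee_fin ?(ltW C0)// !muleA.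
  by apply: IHn => x; exact: integral_ge0.
rewrite -ge0_integralZl//; last 3 first.
- exact: (@measurable_fun_fubini_tonelli_F _ _ _ _ R (lebesgue_rV n) _ mT).
- by move=> y _; exact: integral_ge0.
- by rewrite lee_fin ltW.
apply: le_integral_nonmeasurable => y _.
  by do 3 (apply: integral_ge0 => ? _).
rewrite -ge0_integralZl//; last 2 first.
- by apply: measurable_trilinear_density => //; exact: mS.
- by rewrite lee_fin ltW.
apply: le_integral_nonmeasurable => x _; last exact: slice.
by do 2 (apply: integral_ge0 => ? _).
Qed.

End euclidean_space.

(** * Duality *)

Section duality.
Local Open Scope ereal_scope.
Import HBNNSimple.

(** The natural test function is [eta = S^r], as then [S eta^(1-1/r) = S^r] and
    one may divide by a power of the integral; this requires the integral to be
    finite.  So [S^r] is replaced by a simple function [h <= S^r] restricted to a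
    set of finite measure. *)
Lemma poweR_integral_le_dual d (T : measurableType d) (R : realType)
    (mu : {sigma_finite_measure set T -> \bar R}) (S : T -> \bar R) (r M : R) :
  (1 <= r)%R -> (0 <= M)%R -> (forall x, 0 <= S x) ->
  (forall eta : T -> \bar R, measurable_fun [set: T] eta ->
     (forall x, 0 <= eta x) ->
     \int[mu]_x (S x * eta x `^ (1 - r^-1))
       <= M%:E * (\int[mu]_x eta x) `^ (1 - r^-1)) ->
  \int[mu]_x (S x `^ r) <= (M `^ r)%:E.
Proof.
move=> r1 M0 S0 H.
have r0 : (0 < r)%R by lra.
have rV0 : (0 < r^-1)%R by rewrite invr_gt0.
have rV1 : (r^-1 <= 1)%R by rewrite invf_le1.
have /sigma_finiteP[F [TF ndF Foo]] := sigma_finiteT mu.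
rewrite ge0_integralE//; last by move=> x _; exact: poweR_ge0.
apply: ge_ereal_sup => _ [h /= hS <-].
rewrite patch_setT in hS.
rewrite -integralT_nnsfun TF.
have mh A : measurable_fun A (EFin \o h).
  by apply/measurable_EFinP; exact: measurable_funTS.
have h0 x : 0 <= (h x)%:E by rewrite lee_fin; exact: fun_ge0.
have hF := @ge0_nondecreasing_set_cvg_integral _ _ _ F (EFin \o h) mu ndF
  (fun i => (Foo i).1) (fun i => mh _) (fun i x _ => h0 x).
rewrite -(cvg_lim _ hF)//; apply: lime_le; first by apply/cvg_ex; eexists; exact: hF.
apply: nearW => n.
set X := \int[mu]_(x in F n) (EFin \o h) x.
have X0 : 0 <= X by apply: integral_ge0 => x _; exact: h0.
have Xfin : X < +oo.
  have [N [_ HN]] := simple_bounded h.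
  have {}HN x : (h x <= N + 1)%R.
    by apply: le_trans (ler_norm _) _; apply: HN => //; rewrite ltrDl.
  have N1 : 0 <= (N + 1)%:E by rewrite lee_fin (le_trans _ (HN point))// fun_ge0.
  apply: (@le_lt_trans _ _ (\int[mu]_(x in F n) (cst (N + 1)%:E x))).
    by apply: le_integral_nonmeasurable => // x _; rewrite lee_fin.
  rewrite integral_cst; last exact: (Foo n).1.
  by rewrite lte_mul_pinfty//; exact: (Foo n).2.
pose eta := (EFin \o h) \_ (F n).
have meta : measurable_fun [set: T] eta.
  by apply/(measurable_restrictT _ _).1 => //; exact: (Foo n).1.
have eta0 x : 0 <= eta x by apply: erestrict_ge0 => z _; exact: h0.
have XE : X = \int[mu]_x eta x by rewrite /X integral_mkcond.
have key : X <= M%:E * X `^ (1 - r^-1).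
  rewrite {1}XE [in leRHS]XE; apply: le_trans (H _ meta eta0).
  apply: le_integral_nonmeasurable => x _ //.
  have etaS : eta x <= S x `^ r.
    by apply: le_trans (hS x); rewrite /eta /patch; case: ifPn.
  rewrite [leLHS](_ : _ = eta x `^ r^-1 * eta x `^ (1 - r^-1)); last first.
    rewrite -poweRD ?subrKC ?poweRe1//.
    by apply: add_neq0_poweRD_def; rewrite subrKC oner_neq0.
  rewrite lee_wpmul2r ?poweR_ge0//.
  have := ge0_le_poweR (ltW rV0) (eta0 x) etaS.
  by rewrite -poweRrM divff ?gt_eqF// poweRe1.
move: X0 Xfin key; case: X {XE} => [X| |]// X0 _.
rewrite poweR_EFin -EFinM !lee_fin in X0 *.
move: X0; rewrite le_eqVlt => /predU1P[<- _|X0 key]; first exact: powR_ge0.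
have {}key : (X `^ r^-1 <= M)%R.
  rewrite -(ler_pM2r (powR_gt0 (1 - r^-1) X0)) -powRD ?subrKC ?powRr1 ?(ltW X0)//.
  by apply/implyP => _; rewrite gt_eqF.
have := @ge0_ler_powR _ r (ltW r0) _ _ (powR_ge0 _ _) M0 key.
by rewrite -powRrM mulVf ?gt_eqF// powRr1// ltW.
Qed.

End duality.

(** * From the operator norm to a scalar majorant *)

Section operator_norm.
Context (R : realType) (d : nat).
Local Open Scope ereal_scope.

Lemma eucl_norm_ge0 (v : 'rV[R]_d) : (0 <= eucl_norm v)%R.
Proof. exact: sqrtr_ge0. Qed.

Lemma le_coord_eucl_norm (v : 'rV[R]_d) i : (`|v ord0 i| <= eucl_norm v)%R.
Proof.
rewrite -sqrtr_sqr /eucl_norm ler_wsqrtr// (bigD1 i)//= lerDl.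
by apply: sumr_ge0 => j _; exact: sqr_ge0.
Qed.

Lemma op_norm_le (M : 'M[\bar R]_d) (s : \bar R) : (0 < d)%N -> 0 <= s ->
  (forall i j, `|M i j| <= s) -> op_norm M <= (d%:R ^+ 2)%:E * s.
Proof.
move=> d0 s0 Ms; have d0' : (0 < d%:R :> R)%R by rewrite ltr0n.
case: s s0 Ms => [s| |]// s0 Ms; last first.
  by rewrite gt0_muley ?leey// lte_fin exprn_gt0.
rewrite lee_fin in s0.
apply: ge_ereal_sup => _ [v /= v0 <-].
set N := eucl_norm v.
have N0 : (0 <= N)%R by exact: eucl_norm_ge0.
have wle i : `|emx_apply M v i| <= (d%:R * s * N)%:E.
  apply: le_trans (lee_abs_sum _ _ _) _.
  apply: (@le_trans _ _ (\sum_(j < d) (s * N)%:E)).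
    apply: lee_sum => j _; rewrite abseM EFinM; apply: lee_pmul => //.
    by rewrite abse_EFin lee_fin le_coord_eucl_norm.
  by rewrite sumEFin lee_fin sumr_const card_ord -[leLHS]mulr_natl mulrA.
have nle : eeucl_norm (emx_apply M v) <= (d%:R ^+ 2 * s * N)%:E.
  rewrite -[leRHS]gee0_abs ?lee_fin ?mulr_ge0 ?exprn_ge0//.
  rewrite -sqrte_sqr /eeucl_norm lee_sqrt ?sqre_ge0//.
  apply: (@le_trans _ _ (\sum_(i < d) ((d%:R * s * N) ^+ 2)%:E)).
    apply: lee_sum => i _; rewrite EFin_expe lee_sqr//.
    by rewrite lee_fin !mulr_ge0.
  rewrite sumEFin -EFin_expe lee_fin sumr_const card_ord -[leLHS]mulr_natl.
  rewrite [leRHS](_ : _ = d%:R ^+ 2 * (d%:R * s * N) ^+ 2)%R; last by ring.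
  by rewrite ler_wpM2r ?sqr_ge0// ler_eXnr// ler1n.
apply: (@le_trans _ _ ((d%:R ^+ 2 * s * N)%:E * (N^-1)%:E)).
  by rewrite lee_wpmul2r// lee_fin invr_ge0.
rewrite -!EFinM lee_fin -[leLHS]mulrA ler_piMr// ?mulr_ge0 ?exprn_ge0//.
by have [->|N1] := eqVneq N 0%R; [rewrite mul0r|rewrite divff].
Qed.

End operator_norm.

Section kernel_bound.
Context (R : realType).
Local Open Scope ereal_scope.

Lemma le_riesz (t N s : R) : (t <= 1)%R -> (0 < N)%R -> (`|s| <= N)%R ->
  (N `^ (t - 1))%:E <= riesz t s.
Proof.
move=> t1 N0 sN; rewrite /riesz; case: ifPn => [_|s0]; first exact: leey.
have as0 : (0 < `|s|)%R by rewrite normr_gt0.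
rewrite lee_fin -opprB !powRN lef_pV2 ?posrE ?powR_gt0//.
by apply: ge0_ler_powR => //; rewrite ?subr_ge0// nnegrE ltW.
Qed.

(** Every coordinate satisfies [|y_k| <= |y|] and [t - 1 <= 0], hence
    [|y|^(alpha-n) = (|y|^(t-1))^n] is at most the product of the [|y_k|^(t-1)];
    the tensor accounts for [|y|^2]. *)
Lemma kernel_le_riesz_rV n (alpha : R) (y : 'rV[R]_n) i j :
  (0 < n)%N -> (alpha <= n%:R)%R ->
  (eucl_norm y `^ (alpha - n%:R - 2) * `|tensor y y i j|)%:E
    <= riesz_rV (alpha / n%:R) y.
Proof.
move=> n0 alphan; have n0' : (0 < n%:R :> R)%R by rewrite ltr0n.
have t1 : (alpha / n%:R <= 1)%R by rewrite ler_pdivrMr// mul1r.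
set t := (alpha / n%:R)%R in t1 *.
rewrite mxE normrM; set N := eucl_norm y.
have := eucl_norm_ge0 y; rewrite -/N le_eqVlt => /predU1P[N0|N0].
  have -> : (`|y ord0 i| = 0)%R.
    have := le_coord_eucl_norm y i; rewrite -/N -N0 => h.
    by apply/eqP; rewrite eq_le h normr_ge0.
  by rewrite mul0r mulr0; exact: riesz_rV_ge0.
apply: (@le_trans _ _ ((N `^ (t - 1)) ^+ n)%:E).
  rewrite lee_fin -powR_mulrn ?powR_ge0// -powRrM.
  rewrite (_ : ((t - 1) * n%:R = alpha - n%:R - 2 + 2)%R); last first.
    by rewrite /t; field; rewrite gt_eqF.
  rewrite [leRHS]powRD; last by apply/implyP => _; rewrite gt_eqF.
  rewrite ler_wpM2l ?powR_ge0// powR_mulrn ?(ltW N0)// expr2.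
  by apply: ler_pM => //; exact: le_coord_eucl_norm.
have prod_ge m (F : 'I_m -> \bar R) (c : R) : (0 <= c)%R ->
    (forall k, c%:E <= F k) -> (c ^+ m)%:E <= \big[*%E/1%E]_(k < m) F k.
  move=> c0; elim: m F => [|m IH] F cF; first by rewrite big_ord0 expr0.
  rewrite big_ord_recl exprS EFinM; apply: lee_pmul => //.
  - by rewrite lee_fin exprn_ge0.
  - by apply: IH => k; exact: cF.
apply: prod_ge => [|k]; first exact: powR_ge0.
by apply: le_riesz => //; exact: le_coord_eucl_norm.
Qed.

Lemma op_norm_ge0 n (M : 'M[\bar R]_n) : (0 < n)%N -> 0 <= op_norm M.
Proof.
move=> n0; pose v : 'rV[R]_n := const_mx 1%R.
have v0 : v != 0%R.
  by apply/eqP => /rowP/(_ (Ordinal n0)); rewrite !mxE => /eqP; rewrite oner_eq0.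
apply: (@le_trans _ _ (eeucl_norm (emx_apply M v) * ((eucl_norm v)^-1)%:E)).
  by rewrite mule_ge0 ?sqrte_ge0// lee_fin invr_ge0 eucl_norm_ge0.
by apply: ereal_sup_ubound; exists v.
Qed.

End kernel_bound.

Section majorant.
Context (R : realType) (d : nat).
Local Open Scope ereal_scope.
Local Notation mu := (@lebesgue_measure R).
Local Notation L := (@lebesgue_rV R d).

(** The exponent 0 and the constant function 1 fill the third slot of the
    trilinear density, whose factor is then 1. *)
Definition J_majorant (t a b : R) (phi psi : 'rV[R]_d -> \bar R) (x : 'rV[R]_d) :=
  \int[mu]_theta ((\1_(`[0%R, 1%R]%classic : set R) theta)%:E *
    \int[L]_y trilinear_density t a b 0 phi psi (cst 1) theta y x).

Lemma J_majorant_ge0 t a b phi psi x : 0 <= J_majorant t a b phi psi x.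
Proof.
apply: integral_ge0 => theta _; rewrite mule_ge0 ?lee_fin//.
by apply: integral_ge0 => y _; exact: trilinear_density_ge0.
Qed.

Lemma measurable_segment_density t a b c phi psi eta :
  measurable_fun [set: 'rV[R]_d] phi -> measurable_fun [set: 'rV[R]_d] psi ->
  measurable_fun [set: 'rV[R]_d] eta ->
  measurable_fun [set: 'rV[R]_d * measurableTypeR R]
    (fun z : 'rV[R]_d * measurableTypeR R =>
      (\1_(`[0%R, 1%R]%classic : set R) z.2)%:E *
      \int[L]_y trilinear_density t a b c phi psi eta z.2 y z.1).
Proof.
move=> mphi mpsi meta; pose T1 := measurableTypeR R.
apply: emeasurable_funM.
  apply/measurable_EFinP; apply: (measurableT_comp _ (@measurable_snd _ _ 'rV[R]_d T1)).
  exact: measurable_indic.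
apply: (@measurable_fun_fubini_tonelli_F _ _ ('rV[R]_d * T1)%type 'rV[R]_d R L
  (fun z => trilinear_density t a b c phi psi eta z.1.2 z.2 z.1.1)).
  apply: measurable_trilinear_density => //.
    exact: (measurableT_comp measurable_snd).
  exact: (measurableT_comp measurable_fst).
by move=> z; exact: trilinear_density_ge0.
Qed.

Lemma measurable_J_majorant t a b phi psi :
  measurable_fun [set: 'rV[R]_d] phi -> measurable_fun [set: 'rV[R]_d] psi ->
  measurable_fun [set: 'rV[R]_d] (J_majorant t a b phi psi).
Proof.
move=> mphi mpsi.
have m1 : measurable_fun [set: 'rV[R]_d] (cst 1 : 'rV[R]_d -> \bar R).
  exact: measurable_cst.
apply: (@measurable_fun_fubini_tonelli_F _ _ _ _ R mu _
  (measurable_segment_density t a b 0 mphi mpsi m1)).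
move=> z; rewrite mule_ge0 ?lee_fin//.
by apply: integral_ge0 => y _; exact: trilinear_density_ge0.
Qed.

(** Testing the majorant against [eta^c] restores the third factor of the density,
    and Tonelli's theorem moves the integral in [theta] outside. *)
Lemma integral_J_majorant_poweR t a b c phi psi eta :
  measurable_fun [set: 'rV[R]_d] phi -> measurable_fun [set: 'rV[R]_d] psi ->
  measurable_fun [set: 'rV[R]_d] eta ->
  \int[L]_x (J_majorant t a b phi psi x * eta x `^ c) =
  \int[mu]_theta ((\1_(`[0%R, 1%R]%classic : set R) theta)%:E *
    \int[L]_y \int[L]_x trilinear_density t a b c phi psi eta theta y x).
Proof.
move=> mphi mpsi meta; pose T1 := measurableTypeR R.
have m1 : measurable_fun [set: 'rV[R]_d] (cst 1 : 'rV[R]_d -> \bar R).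
  exact: measurable_cst.
have D0 := @trilinear_density_ge0.
have w0 theta : 0 <= (\1_(`[0%R, 1%R]%classic : set R) theta)%:E :> \bar R.
  by rewrite lee_fin.
transitivity (\int[L]_x \int[mu]_theta ((\1_(`[0%R, 1%R]%classic : set R) theta)%:E *
    \int[L]_y trilinear_density t a b c phi psi eta theta y x)).
  apply: eq_integral => x _; rewrite /J_majorant -ge0_integralZr//; last 3 first.
  - have := measurable_segment_density t a b 0 mphi mpsi m1.
    by move/(measurableT_comp)/(_ (measurable_pair1 x)).
  - by move=> theta _; rewrite mule_ge0// integral_ge0.
  - exact: poweR_ge0.
  apply: eq_integral => theta _; rewrite -muleA; congr (_ * _).
  rewrite -ge0_integralZr//; last 2 first.
  - exact: measurable_trilinear_density.
  - exact: poweR_ge0.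
  apply: eq_integral => y _; rewrite /trilinear_density poweRe0 mule1.
  by rewrite -!muleA; congr (_ * (_ * _)); rewrite muleC.
have := @fubini_tonelli _ _ _ _ R L mu _ (measurable_segment_density t a b c mphi mpsi meta).
move=> /= ->; last by move=> z; rewrite mule_ge0// integral_ge0.
apply: eq_integral => theta _.
pose F (z : 'rV[R]_d * 'rV[R]_d) := trilinear_density t a b c phi psi eta theta z.2 z.1.
have mF : measurable_fun [set: 'rV[R]_d * 'rV[R]_d] F.
  exact: measurable_trilinear_density.
have F0 z : 0 <= F z by exact: D0.
have mI := @measurable_fun_fubini_tonelli_F _ _ _ _ R L F mF F0.
apply: etrans (ge0_integralZl L measurableT mI _ (w0 theta)) _.
  by move=> x _; exact: integral_ge0.
apply: (congr1 (fun z : \bar R => _ * z)).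
exact: (@fubini_tonelli _ _ _ _ R L L F mF F0).
Qed.

End majorant.

Section op_norm_J.
Context (R : realType) (d : nat).
Local Open Scope ereal_scope.
Local Notation mu := (@lebesgue_measure R).
Local Notation L := (@lebesgue_rV R d).

(** All entries of [J] are bounded by the same scalar integral, and a matrix with
    entries bounded by [s] has norm at most [d^2 s]. *)
Lemma op_norm_J_le (alpha p q : R) (f g : 'rV[R]_d -> R) (x : 'rV[R]_d) :
  (0 < d)%N -> (alpha <= d%:R)%R -> (0 < p)%R -> (0 < q)%R ->
  (forall x, 0 <= f x)%R -> (forall x, 0 <= g x)%R ->
  op_norm (J alpha f g x) <= (d%:R ^+ 2)%:E *
    J_majorant (alpha / d%:R) p^-1 q^-1 (fun x => (f x `^ p)%:E)
      (fun x => (g x `^ q)%:E) x.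
Proof.
move=> d0 alphad p0 q0 f0 g0.
apply: op_norm_le => //; first exact: J_majorant_ge0.
move=> i j; rewrite mxE; apply: le_trans (abse_integral_nonmeasurable _ _ _) _.
rewrite integral_mkcond; apply: le_integral_nonmeasurable => theta _.
  by apply: erestrict_ge0.
rewrite patchE indicE; case: ifPn => [_|_]; last first.
  by rewrite mul0e.
rewrite mul1e.
apply: le_trans (abse_integral_nonmeasurable _ _ _) _.
apply: le_integral_nonmeasurable => y _ //.
have root (u s : R) : (0 <= u)%R -> (0 < s)%R -> (u `^ s)%:E `^ s^-1 = u%:E.
  by move=> u0 s0; rewrite poweR_EFin -powRrM divff ?gt_eqF// powRr1.
rewrite /trilinear_density poweRe0 mule1 !root//.
rewrite abse_EFin -mulrA normrM ger0_norm ?mulr_ge0// !EFinM lee_wpmul2l//.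
  by rewrite lee_fin mulr_ge0.
by rewrite normrM (ger0_norm (powR_ge0 _ _)) kernel_le_riesz_rV.
Qed.

End op_norm_J.

Theorem proposition2p3 (R : realType) (d : nat) (alpha p q r : R)
    (hd : (1 <= d)%N)
    (halpha : 0 < alpha < d%:R)
    (hp : 1 < p < d%:R / alpha)
    (hq : 1 < q < d%:R / alpha)
    (hr : 1 <= r)
    (hpqr : p^-1 + q^-1 = r^-1 + alpha / d%:R) :
  exists C : R, 0 < C /\
    forall f g : 'rV[R]_d -> R,
      (forall x, 0 <= f x) -> (forall x, 0 <= g x) ->
      f \in Lfun (lebesgue_rV d) p%:E ->
      g \in Lfun (lebesgue_rV d) q%:E ->
      ('N[lebesgue_rV d]_(r%:E) [op_norm \o J alpha f g]
        <= C%:E * 'N[lebesgue_rV d]_(p%:E) [EFin \o f]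
                * 'N[lebesgue_rV d]_(q%:E) [EFin \o g])%E.
Proof.
have d0 : 0 < d%:R :> R by rewrite ltr0n.
have /andP[alpha0 alphad] := halpha.
have /andP[p1 pd] := hp; have /andP[q1 qd] := hq.
have p0 : 0 < p by lra.
have q0 : 0 < q by lra.
have r0 : 0 < r by lra.
set t := alpha / d%:R in hpqr.
have t01 : 0 < t < 1.
  by rewrite divr_gt0//= ltr_pdivrMr// mul1r.
have exponent s : 1 < s -> s < d%:R / alpha -> t < s^-1 < 1.
  move=> s1 sd; have s0 : 0 < s by lra.
  rewrite invf_lt1// s1 andbT /t -(invf_div d%:R alpha) ltf_pV2 ?posrE//.
  by rewrite divr_gt0.
have ta := exponent _ p1 pd; have tb := exponent _ q1 qd.
have c0 : 0 <= 1 - r^-1 by rewrite subr_ge0 invf_le1.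
have [|C [C0 H]] := trilinear_rV t01 ta tb c0; first by lra.
have Cd0 : 0 < C ^+ d by rewrite exprn_gt0.
have dd0 : 0 < d%:R ^+ 2 :> R by rewrite exprn_gt0.
exists (d%:R ^+ 2 * C ^+ d); split; first by rewrite mulr_gt0.
move=> f g f0 g0; rewrite !inE => /andP[/[!inE]/= mf Nf] /andP[/[!inE]/= mg Ng].
pose phi x := (f x `^ p)%:E; pose psi x := (g x `^ q)%:E.
have mphi : measurable_fun setT phi.
  apply/measurable_EFinP.
  exact: (measurableT_comp (measurable_powR p) mf).
have mpsi : measurable_fun setT psi.
  apply/measurable_EFinP.
  exact: (measurableT_comp (measurable_powR q) mg).
have NE (h : 'rV[R]_d -> R) s : (forall x, 0 <= h x) ->
    ('N[lebesgue_rV d]_(s%:E) [EFin \o h] =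
     (\int[lebesgue_rV d]_x (h x `^ s)%:E) `^ s^-1)%E.
  move=> h0; rewrite unlock; congr (_ `^ _)%E; apply: eq_integral => x _ /=.
  by rewrite ger0_norm.
have fineN (h : 'rV[R]_d -> R) s : finite_norm (lebesgue_rV d) s h ->
    ((fine 'N[lebesgue_rV d]_s [EFin \o h])%:E = 'N[lebesgue_rV d]_s [EFin \o h])%E.
  by move=> Nh; rewrite fineK// ge0_fin_numE// Lnorm_ge0.
set Nf' := fine 'N[lebesgue_rV d]_(p%:E) [EFin \o f].
set Ng' := fine 'N[lebesgue_rV d]_(q%:E) [EFin \o g].
have Nf'E := fineN _ _ Nf; have Ng'E := fineN _ _ Ng.
have Nf'0 : 0 <= Nf' by apply: fine_ge0; exact: Lnorm_ge0.
have Ng'0 : 0 <= Ng' by apply: fine_ge0; exact: Lnorm_ge0.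
pose M := C ^+ d * Nf' * Ng'.
have M0 : 0 <= M by rewrite !mulr_ge0// ltW.
pose S := J_majorant t p^-1 q^-1 phi psi.
have S0 x : (0 <= S x)%E by exact: J_majorant_ge0.
have mS : measurable_fun setT S by exact: measurable_J_majorant.
have phi0 x : (0 <= phi x)%E by rewrite lee_fin powR_ge0.
have psi0 x : (0 <= psi x)%E by rewrite lee_fin powR_ge0.
have SM : (\int[lebesgue_rV d]_x (S x `^ r) <= (M `^ r)%:E)%E.
  apply: poweR_integral_le_dual => // eta meta eta0.
  rewrite integral_J_majorant_poweR//.
  set B := (X in (_ <= X)%E).
  have B0 : (0 <= B)%E by rewrite mule_ge0 ?poweR_ge0.
  have w0 theta : (0 <= (\1_(`[0%R, 1%R]%classic : set R) theta)%:E :> \bar R)%E.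
    by rewrite lee_fin.
  apply: (@le_trans _ _ (\int[@lebesgue_measure R]_theta
      ((\1_(`[0%R, 1%R]%classic : set R) theta)%:E * B))%E).
    apply: le_integral_nonmeasurable => theta _.
      rewrite mule_ge0//; do 2 (apply: integral_ge0 => ? _).
      exact: trilinear_density_ge0.
    apply: lee_wpmul2l => //; apply: le_trans (H d _ _ _ mphi mpsi meta phi0 psi0 eta0 theta) _.
    by rewrite /B /M !EFinM Nf'E Ng'E (NE f)// (NE g).
  rewrite ge0_integralZr//; last first.
    by apply/measurable_EFinP; exact: measurable_indic.
  rewrite integral_indic//= setIT lebesgue_measure_itv/= lte_fin ltr01.
  by rewrite sube0 mul1e.
rewrite -[X in (_ <= _ * X * _)%E]Nf'E -[X in (_ <= _ * X)%E]Ng'E -!EFinM.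
have -> : d%:R ^+ 2 * C ^+ d * Nf' * Ng' = d%:R ^+ 2 * M by rewrite /M !mulrA.
have K0 : 0 <= d%:R ^+ 2 :> R by exact: ltW.
rewrite unlock.
have -> : ((d%:R ^+ 2 * M)%:E = (((d%:R ^+ 2) `^ r * M `^ r)%:E `^ r^-1))%E.
  have KM0 : 0 <= d%:R ^+ 2 * M by rewrite mulr_ge0.
  by rewrite poweR_EFin -powRM// -powRrM divff ?gt_eqF// powRr1.
apply: ge0_le_poweR; first by rewrite invr_ge0 ltW.
  by apply: integral_ge0 => x _; exact: poweR_ge0.
apply: (@le_trans _ _ (\int[lebesgue_rV d]_x
    (((d%:R ^+ 2) `^ r)%:E * S x `^ r))%E).
  apply: le_integral_nonmeasurable => x _; first exact: poweR_ge0.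
  rewrite -poweR_EFin -poweRM ?lee_fin//; apply: ge0_le_poweR => //; first exact: ltW.
  rewrite /= gee0_abs; last exact: op_norm_ge0.
  by apply: op_norm_J_le => //; exact: ltW.
rewrite ge0_integralZl//; last 2 first.
- exact: measurable_poweR_comp.
- by move=> x _; exact: poweR_ge0.
by rewrite EFinM lee_wpmul2l// lee_fin powR_ge0.
Qed.
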